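(* The polynomial $R$ of twisted graph diagrams is invariant under the twisted moves T1, T2 and T4: if twisted graph diagrams $E$ and $E'$ differ by one such move, then $R(E)=R(E')$.
   Context: Graphs are finite, may be disconnected, may have loops and multiple edges, and may have circle components (components homeomorphic to a circle and without vertices). A twisted graph diagram is a diagram of a graph in $\mathbb{R}^2$ whose multiple points are transverse double points away from vertices, each being either a classical crossing (with over/under information) or a virtual crossing (no such information), with finitely many bars (short transverse marks) on edges or circle components. It is pure if it has no classical crossings. Surface of a pure diagram. For a pure twisted graph diagram $E$ without circle components let $S$ be the compact surface with a disk for each vertex and a band for each edge, the bands attached to the vertex disks in the cyclic order in which the edges leave the vertex in the plane, a band having a half twist for each bar on its edge (relative to the planar orientation of the disks); virtual crossings are ignored (bands pass each other without meeting). Let $k(S)$ be the number of connected components, $n(S)$ the first Betti number, $b(S)$ the number of boundary components, and $t(S)=0$ if $S$ is orientable, $t(S)=1$ otherwise. Put $M(\emptyset)=1$ and $$M(E)=(-1)^{k(S)}y^{n(S)}z^{k(S)-b(S)+n(S)}w^{t(S)}\in\mathbb{Z}[y,z,w]/(w^2-w).$$ For a pure twisted graph diagram $F$ let $o(F)$, resp. $e(F)$, be the number of circle components with an odd, resp. even (possibly zero), number of bars. Put $Q(\emptyset)=1$ and $$Q(F)(y,z,w)=(-1-y)^{e(F)}(-1-yzw)^{o(F)}\sum_{E\subset F}M(E),$$ the sum being over all subdiagrams $E$ given by spanning subgraphs (all vertices, any subset of edges) of $F$ with its circle components removed. States. At a classical crossing whose over-strand joins the ends SW and NE and whose under-strand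 joins NW and SE: spin $+1$ replaces it by two disjoint arcs joining SW to NW and SE to NE; spin $-1$ by two disjoint arcs joining SW to SE and NW to NE; spin $0$ by a vertex of degree 4. A state $S$ of a twisted graph diagram $E$ is the pure twisted graph diagram obtained by choosing a spin at every classical crossing; $\mathcal{S}(E)$ is the set of states, and $\{E\mid S\}:=a^{p-q}$ where $p,q$ are the numbers of crossings with spin $+1$, $-1$. Define $$R(E)(a,z,w)=\sum_{S\in\mathcal{S}(E)}\{E\mid S\}\,Q(S)(-a-2-a^{-1},z,w)\in\mathbb{Z}[a^{\pm1},z,w]/(w^2-w).$$ Moves (inside a disk, diagram unchanged outside): T1 slides a bar along its strand past a virtual crossing; T2 cancels/creates two consecutive bars on a strand; T4 replaces a vertex having one bar on each incident edge-end by the vertex without these bars, with the cyclic order of its edge-ends reversed by a half-twist in which each pair of edge-ends crosses exactly once, virtually (or the inverse replacement). *)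

(* Defs.v *)
From HB Require Import structures.
From mathcomp Require Import all_boot all_algebra.
From mathcomp Require Import boolp.

Set Implicit Arguments.
Unset Strict Implicit.
Unset Printing Implicit Defensive.

Import GRing.Theory.
Local Open Scope ring_scope.

(** * Band surfaces *)

(* A compact surface made of disks and bands, presented combinatorially: each
   disk is given by the cyclic word, read counterclockwise, of the names of the
   bands attached to its boundary; a name occurring in the words occurs exactly
   twice (once for each end of the band).  [twisted c] says that the band [c]
   has an odd number of half twists relative to the given orientations of the
   disks (two half twists in a band do not change the surface). *)
Record band_surface (T : eqType) := BandSurface {
  disks : seq (seq T);
  twisted : pred T
}.

Section Surface.
Variables (T : eqType) (S : band_surface T).

Definition disk := 'I_(size (disks S)).
Definition disk_word (v : disk) : seq T := nth [::] (disks S) v.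
Definition band_end := {v : disk & 'I_(size (disk_word v))}.
Definition band_name (h : band_end) : T := tnth (in_tuple (disk_word (tag h))) (tagged h).
Definition next_end (h : band_end) : band_end := Tagged _ (ordS (tagged h)).

(* [h] and [h'] are the two ends of one band. *)
Definition mates (h h' : band_end) := (h != h') && (band_name h == band_name h').

Definition disk_adj (v v' : disk) :=
  [exists h, exists h', [&& tag h == v, tag h' == v' & mates h h']].

(* Number of connected components. *)
Definition nb_components := n_comp disk_adj predT.

(* First Betti number: the surface retracts onto a graph with one vertex for
   each disk and one edge for each band. *)
Definition betti1 := (size (undup (flatten (disks S))) + nb_components - size (disks S))%N.

(* A corner [(h, s)] is one of the two points at which the sides of a band meet
   the boundary of a disk: seen from the disk, facing the band end [h], the left
   one (last one counterclockwise) for [s = true], the right one for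
   [s = false].  The boundary of the surface consists of the arcs of disk
   boundaries between consecutive band ends and of the sides of the bands; an
   untwisted band joins left to right. *)
Definition corner := (band_end * bool)%type.
Definition boundary_step (p q : corner) :=
  (p.2 && ~~ q.2 && (q.1 == next_end p.1))
  || (mates p.1 q.1 && (q.2 == p.2 (+) ~~ twisted S (band_name p.1))).
Definition boundary_adj (p q : corner) := boundary_step p q || boundary_step q p.

(* Number of boundary components; a disk without bands contributes one. *)
Definition nb_boundary := (n_comp boundary_adj predT + count (@nilp T) (disks S))%N.

(* The disks can be reoriented so that no band is twisted any more. *)
Definition orientable :=
  [exists flip : {ffun disk -> bool}, forall h, forall h',
     mates h h' ==> (flip (tag h) (+) flip (tag h') == twisted S (band_name h))].

End Surface.

(** * Diagrams *)

(* A diagram is encoded by the list of its nodes.  Its nodes cut it into arcs,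
   named by natural numbers; a node lists, counterclockwise, the arcs that leave
   it.  [Classical sw se ne nw] has its over-strand joining [sw] to [ne] and its
   under-strand joining [se] to [nw].  [Point] is an ordinary point of a strand:
   it carries no information, but is needed to describe a circle component
   without bars and crossings ([Point a a]). *)
Inductive node :=
  | Vertex of seq nat
  | Classical of nat & nat & nat & nat
  | Virtual of nat & nat & nat & nat
  | Bar of nat & nat
  | Point of nat & nat.

Definition node_code (n : node) : nat * seq nat :=
  match n with
  | Vertex w => (0, w)
  | Classical a b c d => (1, [:: a; b; c; d])
  | Virtual a b c d => (2, [:: a; b; c; d])
  | Bar a b => (3, [:: a; b])
  | Point a b => (4, [:: a; b])
  end%N.

Definition node_decode (x : nat * seq nat) : option node :=
  match x with
  | (0, w) => Some (Vertex w)
  | (1, [:: a; b; c; d]) => Some (Classical a b c d)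
  | (2, [:: a; b; c; d]) => Some (Virtual a b c d)
  | (3, [:: a; b]) => Some (Bar a b)
  | (4, [:: a; b]) => Some (Point a b)
  | _ => None
  end%N.

Lemma node_codeK : pcancel node_code node_decode.
Proof. by case. Qed.

HB.instance Definition _ := Equality.copy node (pcan_type node_codeK).

Notation code := (seq node).

Definition ends (n : node) : seq nat := (node_code n).2.
Definition arcs (E : code) : seq nat := flatten (map ends E).

Definition well_formed (E : code) := all (fun x => count_mem x (arcs E) == 2) (arcs E).

(* Thickening the nodes and the arcs gives an orientable surface, which embeds
   in the plane iff capping off its boundary yields a sphere for each
   component. *)
Definition planar (E : code) :=
  let S := BandSurface (map ends E) pred0 in
  nb_boundary S == (nb_components S + betti1 S)%N.

Record diagram := Diagram {
  code_of :> code;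
  _ : well_formed code_of;
  _ : planar code_of
}.

Definition relabel (f : nat -> nat) (n : node) : node :=
  match n with
  | Vertex w => Vertex (map f w)
  | Classical a b c d => Classical (f a) (f b) (f c) (f d)
  | Virtual a b c d => Virtual (f a) (f b) (f c) (f d)
  | Bar a b => Bar (f a) (f b)
  | Point a b => Point (f a) (f b)
  end.

Inductive rotate_node : node -> node -> Prop :=
  | rotate_vertex a w : rotate_node (Vertex (a :: w)) (Vertex (rcons w a))
  | rotate_classical a b c d : rotate_node (Classical a b c d) (Classical c d a b)
  | rotate_virtual a b c d : rotate_node (Virtual a b c d) (Virtual b c d a)
  | rotate_bar a b : rotate_node (Bar a b) (Bar b a)
  | rotate_point a b : rotate_node (Point a b) (Point b a).

(* Two encodings of the same diagram: the order of the nodes, the first end of a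
   node, the names of the arcs and the ordinary points are irrelevant. *)
Inductive same : diagram -> diagram -> Prop :=
  | same_refl E : same E E
  | same_sym E E' of same E E' : same E' E
  | same_trans E1 E2 E3 of same E1 E2 & same E2 E3 : same E1 E3
  | same_perm (E E' : diagram) of perm_eq (code_of E) (code_of E') : same E E'
  | same_rotate (E E' : diagram) n n' s of
      rotate_node n n' & E = n :: s :> code & E' = n' :: s :> code : same E E'
  | same_relabel (E E' : diagram) f of
      injective f & E' = map (relabel f) E :> code : same E E'
  | same_point (E E' : diagram) a b s of
      a != b & E = Point a b :: s :> code &
      E' = map (relabel (fun x => if x == b then a else x)) s :> code : same E E'.

(** * Pure diagrams: edges, circle components and the polynomials M and Q *)

Definition vertices (F : code) : seq (seq nat) :=
  pmap (fun n => if n is Vertex w then Some w else None) F.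

Definition passes (n : node) : seq (nat * nat) :=
  match n with
  | Virtual a b c d => [:: (a, c); (b, d)]
  | Bar a b | Point a b => [:: (a, b)]
  | _ => [::]
  end.

Section Pure.
Variable F : code.

Definition arc := seq_sub (arcs F).

Definition arc_adj (x y : arc) :=
  ((ssval x, ssval y) \in flatten (map passes F))
  || ((ssval y, ssval x) \in flatten (map passes F)).

(* The edges and the circle components of a pure diagram, as sets of arcs;
   [strand x] is the one through the arc named [x]. *)
Definition strand (x : nat) : {set arc} :=
  [set y | [exists x' : arc, (ssval x' == x) && connect arc_adj x' y]].
Definition edges : {set {set arc}} := [set:: map strand (flatten (vertices F))].
Definition circles : {set {set arc}} := [set:: map strand (arcs F)] :\: edges.

Definition bars (C : {set arc}) : nat :=
  count (fun n => if n is Bar a _ then strand a == C else false) F.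

(* The surface of the spanning subgraph with edge set [A]. *)
Definition surface (A : {set {set arc}}) : band_surface {set arc} :=
  BandSurface [seq [seq C <- map strand w | C \in A] | w <- vertices F]
              (fun C => odd (bars C)).

Definition nb_odd_circles := #|[set C in circles | odd (bars C)]|.
Definition nb_even_circles := #|[set C in circles | ~~ odd (bars C)]|.

End Pure.

(* The elements of Z[y, z, w] / (w ^ 2 - w) are evaluated in a commutative ring
   in which [w] is meant to be idempotent. *)
Definition polyM (K : comNzRingType) (T : eqType) (S : band_surface T) (y z w : K) : K :=
  let k := nb_components S in let n := betti1 S in let b := nb_boundary S in
  let t := if orientable S then 0%N else 1%N in
  (-1) ^+ k * y ^+ n * z ^+ (k + n - b) * w ^+ t.

Definition polyQ (K : comNzRingType) (F : code) (y z w : K) : K :=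
  (- 1 - y) ^+ nb_even_circles F * (- 1 - y * z * w) ^+ nb_odd_circles F
  * \sum_(A in powerset (edges F)) polyM (surface A) y z w.

(** * States *)

Inductive spin := SpinPlus | SpinMinus | SpinZero.

Definition spin_code x := match x with SpinPlus => Some true | SpinMinus => Some false | SpinZero => None end.
Definition spin_decode x := match x with Some true => SpinPlus | Some false => SpinMinus | None => SpinZero end.
Lemma spin_codeK : cancel spin_code spin_decode. Proof. by case. Qed.
HB.instance Definition _ := Finite.copy spin (can_type spin_codeK).

Definition is_classical (n : node) := if n is Classical _ _ _ _ then true else false.
Definition nb_classical (E : code) := count is_classical E.

Definition smooth (x : spin) (sw se ne nw : nat) : code :=
  match x with
  | SpinPlus => [:: Point sw nw; Point se ne]
  | SpinMinus => [:: Point sw se; Point nw ne]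
  | SpinZero => [:: Vertex [:: sw; se; ne; nw]]
  end.

(* The state given by the spins of the successive classical crossings. *)
Fixpoint state (E : code) (s : seq spin) : code :=
  match E, s with
  | Classical a b c d :: E', x :: s' => smooth x a b c d ++ state E' s'
  | n :: E', _ => n :: state E' s
  | [::], _ => [::]
  end.

(** * The ring Z[a^+-1, z, w] / (w ^ 2 - w) and the polynomial R *)

(* Laurent polynomials, as a subring of the field of rational functions. *)
Definition laurent_pred : {pred {fraction {poly int}}} :=
  fun x => `[< exists (p : {poly int}) (n : nat),
    x = FracField.tofrac p / FracField.tofrac 'X ^+ n >].

Lemma laurent_subring_closed : subring_closed laurent_pred.
Proof.
have X0 n : FracField.tofrac ('X : {poly int}) ^+ n != 0.
  by rewrite expf_neq0 // tofrac_eq0 polyX_eq0.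
split.
- by apply/asboolP; exists 1, 0%N; rewrite expr0 divr1 tofrac1.
- move=> _ _ /asboolP[p [m ->]] /asboolP[q [n ->]]; apply/asboolP.
  exists (p * 'X^n - q * 'X^m), (m + n)%N.
  rewrite tofracB !tofracM !tofracXn exprD mulrBl; congr (_ - _).
    by rewrite -mulf_div divff // mulr1.
  by rewrite [X in _ = _ / X]mulrC -mulf_div divff // mulr1.
- move=> _ _ /asboolP[p [m ->]] /asboolP[q [n ->]]; apply/asboolP.
  by exists (p * q), (m + n)%N; rewrite tofracM exprD mulf_div.
Qed.

HB.instance Definition _ :=
  GRing.isSubringClosed.Build {fraction {poly int}} laurent_pred laurent_subring_closed.

Record laurent := Laurent { lval : {fraction {poly int}}; _ : lval \in laurent_pred }.
HB.instance Definition _ := [isSub for lval].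
HB.instance Definition _ := [Choice of laurent by <:].
HB.instance Definition _ := [SubChoice_isSubComNzRing of laurent by <:].

Lemma laurentX_proof : FracField.tofrac 'X \in laurent_pred.
Proof. by apply/asboolP; exists 'X, 0%N; rewrite expr0 divr1. Qed.
Lemma laurentV_proof : (FracField.tofrac 'X)^-1 \in laurent_pred.
Proof. by apply/asboolP; exists 1, 1%N; rewrite expr1 tofrac1 mul1r. Qed.

Definition laurentX : laurent := Laurent laurentX_proof.
Definition laurentV : laurent := Laurent laurentV_proof.

(* The coefficients of the outer polynomials in [w] are polynomials in [z]. *)
Definition Rring := {poly %/ ('X^2 - 'X : {poly {poly laurent}})}.

Definition ra : Rring := qpolyC _ (laurentX%:P).
Definition rai : Rring := qpolyC _ (laurentV%:P).
Definition rz : Rring := qpolyC _ 'X.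
Definition rw : Rring := in_qpoly _ 'X.

Definition power_a (m : int) : Rring :=
  match m with Posz n => ra ^+ n | Negz n => rai ^+ n.+1 end.

Definition polyR (E : code) : Rring :=
  \sum_(s : (nb_classical E).-tuple spin)
    power_a ((count_mem SpinPlus s)%:Z - (count_mem SpinMinus s)%:Z)
    * polyQ (state E s) (- ra - 2%:R - rai) rz rw.

(** * Moves *)

(* [braid s ns cs t] : a braid of virtual crossings [ns], drawn from top to
   bottom, from the sequence of strands [s] to [t], both listed from right to
   left (i.e. counterclockwise for the arcs leaving the disk at the top, and for
   the arcs leaving upwards a vertex placed at the bottom).  Strands are
   numbered, and paired with the name of their current arc; [cs] records the
   pairs of strands that cross, so that [half_twist] covers every way of drawing
   a half-twist in which each pair of strands crosses exactly once. *)
Inductive braid :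
    seq (nat * nat) -> code -> seq (nat * nat) -> seq (nat * nat) -> Prop :=
  | braid_id s : braid s [::] [::] s
  | braid_cross s1 s2 i x x' j y y' ns cs t of
      braid (s1 ++ [:: (j, y'), (i, x') & s2]) ns cs t :
      braid (s1 ++ [:: (i, x), (j, y) & s2])
            (Virtual x y x' y' :: ns) ((i, j) :: cs) t.

Definition half_twist (top : seq nat) (ns : code) (bot : seq nat) : Prop :=
  let r := size top in
  size bot = r /\
  exists2 cs,
    braid (zip (iota 0 r) top) ns cs (zip (rev (iota 0 r)) bot) &
    forall i j, (i < j < r)%N -> (count_mem (i, j) cs + count_mem (j, i) cs = 1)%N.

Definition T1 (E E' : diagram) : Prop :=
  exists a b c d e s,
    E = [:: Bar a b, Virtual b c d e & s] :> code /\
    E' = [:: Virtual a c b e, Bar b d & s] :> code.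

Definition T2 (E E' : diagram) : Prop :=
  exists a b c s,
    E = [:: Bar a b, Bar b c & s] :> code /\
    E' = [:: Point a b, Point b c & s] :> code.

(* [top] lists the arcs that leave the disk of the move. *)
Definition T4 (E E' : diagram) : Prop :=
  exists top bot bot' ns s,
    [/\ size bot = size top, half_twist top ns bot',
        E = Vertex bot :: [seq Bar x.1 x.2 | x <- zip top bot] ++ s :> code &
        E' = Vertex bot' :: ns ++ s :> code].

Definition differ_by (move : diagram -> diagram -> Prop) (E E' : diagram) : Prop :=
  exists E1 E1', [/\ same E E1, same E' E1' & move E1 E1' \/ move E1' E1].

(* Main.v *)
From mathcomp Require Import all_boot all_algebra finmap zify.
From mathcomp Require Import boolp.
Require Import Defs.

(* Since [polyR] is a sum over states and the moves do not involve classical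
   crossings, it suffices to compare the polynomial Q of corresponding states.
   Q only depends on the strands (classes of arcs modulo the passages through
   bars and virtual crossings), on the parity of the bars on each of them and on
   the cyclic words that they form around the vertices.  T1 and T2 change none
   of this.  T4 reverses the word of a vertex and toggles the parity of each
   strand once for each of its ends at this vertex: this is what one sees after
   turning over the corresponding disk of the surface, which does not change the
   surface.  That a strand has two ends or none, so that the parities do change
   as required, follows by contracting its passages one at a time. *)

Set Implicit Arguments.
Unset Strict Implicit.
Unset Printing Implicit Defensive.

Import GRing.Theory.
Local Open Scope ring_scope.

(** * Isomorphisms of band surfaces *)

(** The edges and circle components of a code [F] are sets over a type that depends on [F], so the
    sums defining Q for two diagrams range over unrelated types. Naming the strands by natural
    numbers removes this dependence: [namedQ] sees only words and lists over [nat], and the two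
    sides of a move can be given the same naming, up to a renaming of arcs. States raise the same
    obstacle, being indexed by tuples whose length depends on the diagram; [state_sum] replaces them
    by a recursion on the code. In T4 the two sides also have different arcs inside the disk of the
    move. Both are contracted onto the arcs [top] that leave the disk, where they become the same
    vertex, with word [rev top]: on the side with bars the reversal comes from turning the disk
    over, on the other side from the half-twist. A contraction is sound only if the arc that
    disappears occurs nowhere else, which is why the fact that every arc has exactly two ends is
    carried through all states. *)

Section BandEnds.
Variables (T : eqType) (S : band_surface T).

Lemma band_end_inj (h h' : band_end S) :
  tag h = tag h' :> nat -> tagged h = tagged h' :> nat -> h = h'.
Proof.
case: h h' => [v j] [v' j'] /= /val_inj ev; case: v' / ev j' => j' ej.
by congr (Tagged _ _); apply: val_inj.
Qed.

Lemma band_nameE x0 (h : band_end S) :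
  band_name h = nth x0 (nth [::] (disks S) (tag h)) (tagged h).
Proof. exact: (tnth_nth x0). Qed.

Lemma band_name_in (h : band_end S) : band_name h \in flatten (disks S).
Proof.
apply/flattenP; exists (disk_word (tag h)); first exact: mem_nth.
exact: mem_tnth.
Qed.

(** The type of band ends is dependent; building ends from plain indices allows maps between ends to
    be given by functions on numbers. *)
Definition mk_end i j (Hi : (i < size (disks S))%N)
    (Hj : (j < size (nth [::] (disks S) i))%N) : band_end S :=
  Tagged (fun v : disk S => 'I_(size (disk_word v)))
    (Ordinal Hj : 'I_(size (disk_word (Ordinal Hi)))).

Lemma next_end_inj : injective (@next_end _ S).
Proof.
move=> h h' e; have et : tag h = tag h' by have := congr1 tag e.
case: h h' et e => [v j] [v' j'] /= ev; case: v' / ev j' => j'.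
by move=> /eqP; rewrite eq_Tagged /= => /eqP/ordS_inj->.
Qed.

Lemma mates_sym : symmetric (@mates _ S).
Proof. by move=> h h'; rewrite /mates eq_sym [band_name h == _]eq_sym. Qed.

Lemma disk_adj_sym : symmetric (@disk_adj _ S).
Proof.
suff H v v' : disk_adj v v' -> @disk_adj _ S v' v by move=> v v'; apply/idP/idP; apply: H.
case/existsP=> h /existsP[h' /and3P[hv hv' m]].
by apply/existsP; exists h'; apply/existsP; exists h; rewrite hv hv' mates_sym.
Qed.

Lemma boundary_adj_sym : symmetric (@boundary_adj _ S).
Proof. by move=> p q; rewrite /boundary_adj orbC. Qed.

Lemma sum_band_end (F : forall v : disk S, 'I_(size (disk_word v)) -> nat) :
  (\sum_(h : band_end S) F (tag h) (tagged h) = \sum_v \sum_j F v j)%N.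
Proof. by rewrite (sig_big_dep xpredT (fun _ => xpredT)). Qed.

Lemma count_word c (v : disk S) :
  count_mem c (disk_word v) = (\sum_(h : band_end S | tag h == v) (band_name h == c))%N.
Proof.
rewrite big_mkcond /=.
rewrite (sum_band_end (fun (u : disk S) j => if u == v then
   (tnth (in_tuple (disk_word u)) j == c : nat) else 0%N)).
rewrite (bigD1 v) //= [X in (_ + X)%N]big1 ?addn0; last first.
  by move=> u /negPf uv; rewrite big1 // => j _; rewrite uv.
rewrite eqxx -sum1_count big_mkcond /= (big_tnth _ _ (disk_word v)).
by apply: eq_bigr => j _; case: eqP.
Qed.

Lemma count_disks c :
  count_mem c (flatten (disks S)) = (\sum_(h : band_end S) (band_name h == c))%N.
Proof.
rewrite (sum_band_end (fun (u : disk S) j => (tnth (in_tuple (disk_word u)) j == c : nat))).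
rewrite count_flatten sumnE big_map (big_nth [::]) big_mkord; apply: eq_bigr => v _.
rewrite -sum1_count big_mkcond /= -[nth _ _ _]/(disk_word v) (big_tnth _ _ (disk_word v)).
by apply: eq_bigr => j _; case: eqP.
Qed.

Lemma card_band_end : #|{: band_end S}| = size (flatten (disks S)).
Proof.
rewrite -sum1_card (sum_band_end (fun _ _ => 1%N)) size_flatten /shape sumnE big_map.
by rewrite (big_nth [::]) big_mkord; apply: eq_bigr => v _; rewrite sum1_card card_ord.
Qed.

End BandEnds.

Lemma n_comp_bij (A B : finType) (h : B -> A) (e : rel A) (e' : rel B) :
  symmetric e -> symmetric e' -> bijective h ->
  (forall x y, e (h x) (h y) = e' x y) -> n_comp e predT = n_comp e' predT.
Proof.
move=> se se' bh he.
have ce := sym_connect_sym se; have ce' := sym_connect_sym se'.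
have cl : closed e predT by [].
rewrite (adjunction_n_comp h ce ce' cl); first exact: eq_n_comp_r.
apply: strict_adjunction => //; first exact: bij_inj.
by apply/subsetP=> x _; case: bh => g _ gK; rewrite -[x]gK codom_f.
Qed.

Section SurfaceIso.
Variables (T T' : eqType) (S : band_surface T) (S' : band_surface T').
Variables (f : disk S -> disk S') (g : band_end S -> band_end S') (flip : disk S -> bool).
Hypothesis size_disks : size (disks S) = size (disks S').
Hypothesis size_ends : size (flatten (disks S)) = size (flatten (disks S')).
Hypothesis f_inj : injective f.
Hypothesis g_inj : injective g.
Hypothesis tag_g : forall h, tag (g h) = f (tag h).
Hypothesis name_g : forall h h',
  (band_name (g h) == band_name (g h')) = (band_name h == band_name h').
Hypothesis next_g : forall h, ~~ flip (tag h) -> g (next_end h) = next_end (g h).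
Hypothesis next_gN : forall h, flip (tag h) -> next_end (g (next_end h)) = g h.
Hypothesis twisted_g : forall h h', mates h h' ->
  twisted S' (band_name (g h)) =
  twisted S (band_name h) (+) (flip (tag h) (+) flip (tag h')).

Let f_bij : bijective f.
Proof. by apply: inj_card_bij => //; rewrite !card_ord size_disks. Qed.

Let g_bij : bijective g.
Proof. by apply: inj_card_bij => //; rewrite !card_band_end size_ends. Qed.

Let mates_g h h' : mates (g h) (g h') = mates h h'.
Proof. by rewrite /mates (inj_eq g_inj) name_g. Qed.

Lemma nb_components_iso : nb_components S = nb_components S'.
Proof.
apply/esym/(n_comp_bij (@disk_adj_sym _ _) (@disk_adj_sym _ _) f_bij) => v v'.
apply/existsP/existsP => -[h /existsP[h' /and3P[]]].
  have [i gK iK] := g_bij; rewrite -[h]iK -[h']iK !tag_g mates_g !(inj_eq f_inj) => hv hv' m.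
  by exists (i h); apply/existsP; exists (i h'); rewrite hv hv' m.
move=> /eqP hv /eqP hv' m; exists (g h); apply/existsP; exists (g h').
by rewrite !tag_g hv hv' !eqxx mates_g.
Qed.

(** Turning a disk over exchanges left and right as seen from it, so the side of a corner is toggled
    exactly on the flipped disks. *)
Let gc (p : corner S) : corner S' := (g p.1, p.2 (+) flip (tag p.1)).

Let arc_step (U : eqType) (R : band_surface U) (p q : corner R) :=
  p.2 && ~~ q.2 && (q.1 == next_end p.1).

(** On a flipped disk the cyclic order is reversed and boundary arcs are traversed backwards, so
    only the symmetric closure of the step is preserved. *)
Let arc_gc p q : arc_step (gc p) (gc q) || arc_step (gc q) (gc p)
   = arc_step p q || arc_step q p.
Proof.
have E (h h' : band_end S) : (g h' == next_end (g h)) =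
    if flip (tag h) then h == next_end h' else h' == next_end h.
  case: ifPn => fl; last by rewrite -next_g // (inj_eq g_inj).
  apply/eqP/eqP => e; last by rewrite e next_gN //; rewrite e in fl.
  have et : tag h' = tag h by apply: f_inj; rewrite -!tag_g e.
  apply/g_inj/(@next_end_inj _ S'); rewrite next_gN ?et //.
have N (h h' : band_end S) : h == next_end h' -> flip (tag h) = flip (tag h').
  by move=> /eqP->.
case: p q => [h s] [h' s']; rewrite /arc_step /gc /= !E.
case e1: (h' == next_end h); case e2: (h == next_end h');
  rewrite ?(N _ _ e1) ?(N _ _ e2);
  by move: (flip (tag h)) (flip (tag h')) => [] []; case: s; case: s'.
Qed.

(** Along a band, the toggles of the sides at its two ends are exactly the correction of the twist
    allowed by [twisted_g]. *)
Lemma nb_boundary_iso :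
  n_comp (@boundary_adj _ S) predT = n_comp (@boundary_adj _ S') predT.
Proof.
have bij_gc : bijective gc.
  have [i gK iK] := g_bij.
  exists (fun q => (i q.1, q.2 (+) flip (tag (i q.1)))) => -[h s] /=;
    by rewrite /gc /= ?gK ?iK -addbA addbb addbF.
apply/esym/(n_comp_bij (@boundary_adj_sym _ _) (@boundary_adj_sym _ _) bij_gc) => p q.
rewrite /boundary_adj /boundary_step -!/(arc_step _ _).
rewrite orbACA arc_gc [RHS]orbACA; congr (_ || _).
rewrite /gc /= !mates_g [mates q.1 p.1]mates_sym.
case m: (mates p.1 q.1) => //=.
have m' : mates q.1 p.1 by rewrite mates_sym.
rewrite (twisted_g m) (twisted_g m').
have /andP[_ /eqP->] := m.
by case: (flip _); case: (flip _); case: (twisted _ _); case: p.2; case: q.2.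
Qed.

Lemma orientable_iso : orientable S = orientable S'.
Proof.
have [i gK iK] := g_bij; have [j fK jK] := f_bij.
apply/existsP/existsP => -[o /forallP oP].
  (* A reorientation is carried over by adding the flips to it, in both directions. *)
  exists [ffun v => o (j v) (+) flip (j v)]; apply/forallP=> h; apply/forallP=> h'.
  rewrite -[h]iK -[h']iK mates_g; apply/implyP => m; rewrite (twisted_g m) !ffunE !tag_g !fK.
  move/forallP: (oP (i h)) => /(_ (i h')); rewrite m /= => /eqP <-.
  by case: (flip _); case: (flip _); case: (o _); case: (o _).
exists [ffun v => o (f v) (+) flip v]; apply/forallP=> h; apply/forallP=> h'.
apply/implyP => m; rewrite !ffunE -!tag_g.
move/forallP: (oP (g h)) => /(_ (g h')); rewrite mates_g m /= (twisted_g m).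
by case: (flip _); case: (flip _); case: (o _); case: (o _); case: (twisted _ _).
Qed.

End SurfaceIso.

Section PolyMIso.
Variables (K : comNzRingType) (y z w : K).
Variables (T T' : eqType) (x0 : T) (x0' : T') (S : band_surface T) (S' : band_surface T').
Local Notation word R i := (nth [::] (disks R) i).
Variables (f : nat -> nat) (g : nat -> nat -> nat) (flip : pred nat) (nm : T -> T').
Hypothesis size_disks : size (disks S') = size (disks S).
Hypothesis size_ends : size (flatten (disks S')) = size (flatten (disks S)).
Hypothesis size_names :
  size (undup (flatten (disks S'))) = size (undup (flatten (disks S))).
Hypothesis count_nil : count (@nilp T') (disks S') = count (@nilp T) (disks S).
Hypothesis f_lt : forall i, (i < size (disks S))%N -> (f i < size (disks S))%N.
Hypothesis f_inj : {in gtn (size (disks S)) &, injective f}.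
Hypothesis size_word : forall i, (i < size (disks S))%N -> size (word S' (f i)) = size (word S i).
Hypothesis g_lt : forall i j, (i < size (disks S))%N -> (j < size (word S i))%N ->
  (g i j < size (word S i))%N.
Hypothesis g_inj : forall i, (i < size (disks S))%N ->
  {in gtn (size (word S i)) &, injective (g i)}.
Hypothesis name_g : forall i j, (i < size (disks S))%N -> (j < size (word S i))%N ->
  nth x0' (word S' (f i)) (g i j) = nm (nth x0 (word S i) j).
Hypothesis nm_inj : {in flatten (disks S) &, injective nm}.
Hypothesis next_g : forall i j, (i < size (disks S))%N -> (j < size (word S i))%N ->
  ~~ flip i -> g i (j.+1 %% size (word S i))%N = ((g i j).+1 %% size (word S i))%N.
Hypothesis next_gN : forall i j, (i < size (disks S))%N -> (j < size (word S i))%N ->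
  flip i -> ((g i (j.+1 %% size (word S i))).+1 %% size (word S i))%N = g i j.
Hypothesis twisted_g : forall h h' : band_end S, mates h h' ->
  twisted S' (nm (band_name h)) =
  twisted S (band_name h) (+) (flip (tag h : 'I__) (+) flip (tag h' : 'I__)).

Let fD_proof (v : disk S) : (f v < size (disks S'))%N.
Proof. by rewrite size_disks f_lt. Qed.
Let fD (v : disk S) : disk S' := Ordinal (fD_proof v).

Let gE_proof (h : band_end S) :
  (g (tag h : 'I__) (tagged h) < size (word S' (f (tag h : 'I__))))%N.
Proof. by rewrite size_word // g_lt // ltn_ord. Qed.
Let gE (h : band_end S) : band_end S' := mk_end (fD_proof (tag h)) (gE_proof h).

Let name_gE h : band_name (gE h) = nm (band_name h).
Proof. by rewrite (band_nameE x0') /= name_g //= ?ltn_ord // -(band_nameE x0). Qed.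

(** The preceding criterion for data on indices: [f] moves the disks, [g i] moves the ends on disk
    [i], [nm] renames the bands, and [flip] selects the disks that are turned over. Injectivity and
    equal sizes make the induced maps bijective. *)
Lemma polyM_iso : polyM S y z w = polyM S' y z w.
Proof.
have fI : injective fD.
  by move=> v v' /(congr1 val) /= /f_inj e; apply/val_inj/e; rewrite inE ltn_ord.
have gI : injective gE.
  move=> h h' e; have et : tag h = tag h'.
    by apply: fI; have /(congr1 tag) := e.
  apply: band_end_inj; first by rewrite et.
  have : g (tag h) (tagged h) = g (tag h') (tagged h').
    by have := congr1 (fun k : band_end S' => tagged k : nat) e.
  have Lh' : (tagged h' < size (word S (tag h)))%N by rewrite et ltn_ord.
  have etn : (tag h' : nat) = tag h by rewrite et.
  by rewrite etn => /g_inj; apply; rewrite ?inE //; apply: ltn_ord.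
have nI h h' : (band_name (gE h) == band_name (gE h')) = (band_name h == band_name h').
  by rewrite !name_gE (inj_in_eq nm_inj) ?band_name_in.
have next1 (h : band_end S) : ~~ flip (tag h : disk S) -> gE (next_end h) = next_end (gE h).
  move=> fl; apply: band_end_inj => //=; rewrite size_word //.
  by apply: next_g => //; apply: ltn_ord.
have next2 (h : band_end S) : flip (tag h : disk S) -> next_end (gE (next_end h)) = gE h.
  move=> fl; apply: band_end_inj => //=; rewrite size_word //.
  by apply: next_gN => //; apply: ltn_ord.
have tw (h h' : band_end S) : mates h h' -> twisted S' (band_name (gE h)) =
    twisted S (band_name h) (+) (flip (tag h : disk S) (+) flip (tag h' : disk S)).
  by move=> m; rewrite name_gE (twisted_g m).
have tg (h : band_end S) : tag (gE h) = fD (tag h) by [].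
have nb : nb_boundary S = nb_boundary S'.
  rewrite /nb_boundary count_nil; congr (_ + _)%N.
  exact: (nb_boundary_iso (flip := fun v : disk S => flip v)
    (esym size_ends) fI gI tg nI next1 next2 tw).
rewrite /polyM /betti1 nb.
rewrite (nb_components_iso (esym size_disks) (esym size_ends) fI gI tg nI).
rewrite (orientable_iso (flip := fun v : disk S => flip v)
  (esym size_disks) (esym size_ends) fI gI tg nI tw).
by rewrite size_disks size_names.
Qed.

End PolyMIso.

(** * Invariance of M under renaming, reordering, rotating and turning over disks *)

Section PolyM.
Variables (K : comNzRingType) (y z w : K).

Lemma size_undup_eq (T : eqType) (s s' : seq T) : s =i s' -> size (undup s) = size (undup s').
Proof.
by move=> e; apply/perm_size/uniq_perm; rewrite ?undup_uniq // => x; rewrite !mem_undup.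
Qed.

Lemma size_undup_map (T T' : eqType) (h : T -> T') (s : seq T) :
  {in s &, injective h} -> size (undup (map h s)) = size (undup s).
Proof.
move=> hI; rewrite -(size_map h (undup s)); apply/perm_size/uniq_perm; rewrite ?undup_uniq //.
  by rewrite map_inj_in_uniq ?undup_uniq // => a b; rewrite !mem_undup; apply: hI.
move=> c; rewrite mem_undup; apply/mapP/mapP => -[d ds ->]; exists d => //;
  by rewrite mem_undup in ds *.
Qed.

Lemma polyM_map (T T' : eqType) (x0 : T) (x0' : T') (h : T -> T') D t t' :
  {in flatten D &, injective h} -> {in flatten D, forall c, t' (h c) = t c} ->
  polyM (BandSurface D t) y z w = polyM (BandSurface (map (map h) D) t') y z w.
Proof.
move=> hI ht; have fl : flatten (map (map h) D) = map h (flatten D) by rewrite map_flatten.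
have W i : (i < size D)%N -> nth [::] (map (map h) D) i = map h (nth [::] D i).
  by move=> Hi; rewrite (nth_map [::]).
apply: (polyM_iso y z w (x0 := x0) (x0' := x0') (f := id) (g := fun _ => id)
  (flip := pred0) (nm := h)) => //=.
- by rewrite size_map.
- by rewrite fl size_map.
- by rewrite fl size_undup_map.
- by rewrite count_map; apply: eq_count => u; rewrite /= /nilp size_map.
- by move=> i Hi; rewrite W // size_map.
- by move=> i _ j j'.
- by move=> i j Hi Hj; rewrite W // (nth_map x0).
- by move=> k k' _; rewrite addbF ht //; apply: band_name_in.
Qed.

Lemma eq_polyM (T : eqType) (x0 : T) D (t t' : pred T) :
  {in flatten D, t' =1 t} ->
  polyM (BandSurface D t) y z w = polyM (BandSurface D t') y z w.
Proof.
move=> tt; rewrite (polyM_map x0 x0 (h := id) (t' := t')) //.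
by rewrite (eq_map (@map_id T)) map_id.
Qed.

Lemma polyM_perm (T : eqType) (x0 : T) (D D' : seq (seq T)) t :
  perm_eq D D' -> polyM (BandSurface D t) y z w = polyM (BandSurface D' t) y z w.
Proof.
move=> pD; have sD := perm_size pD; have fD := perm_flatten pD.
(* [I] lists the positions in [D'] of the successive words of [D]; it serves as the map between the
   disks. *)
have /(perm_iotaP [::])[I pI eD] := pD.
have sI : size I = size D by rewrite sD (perm_size pI) size_iota.
have W i : (i < size D)%N -> nth [::] D' (nth 0 I i)%N = nth [::] D i.
  by move=> Hi; rewrite eD (nth_map 0%N) ?sI.
apply: (polyM_iso y z w (x0 := x0) (x0' := x0) (f := nth 0%N I) (g := fun _ => id)
  (flip := pred0) (nm := id)) => //=.
- by rewrite (perm_size fD).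
- by apply: size_undup_eq => c; rewrite (perm_mem fD).
- by rewrite (permP pD).
- move=> i Hi; rewrite sD; have : nth 0%N I i \in I by rewrite mem_nth ?sI.
  by rewrite (perm_mem pI) mem_iota.
- move=> i j; rewrite !inE -sI => Hi Hj /eqP; rewrite nth_uniq //; first by move/eqP.
  by rewrite (perm_uniq pI) iota_uniq.
- by move=> i /W->.
- by move=> i _ j j'.
- by move=> i j /W->.
- by move=> k k' _; rewrite addbF.
Qed.

Lemma polyM_rot (T : eqType) a (u : seq T) D t :
  polyM (BandSurface (rcons u a :: D) t) y z w =
  polyM (BandSurface ((a :: u) :: D) t) y z w.
Proof.
have p : perm_eq ((a :: u) ++ flatten D) (rcons u a ++ flatten D).
  by rewrite perm_cat2r perm_sym perm_rcons.
(* Position [j] of [rcons u a] is position [j + 1] of [a :: u], cyclically; only disk 0 is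
   affected. *)
apply: (polyM_iso y z w (x0 := a) (x0' := a) (f := id)
  (g := fun i j => if i is 0%N then (j.+1 %% (size u).+1)%N else j)
  (flip := pred0) (nm := id)) => //=.
- exact: (perm_size p).
- exact: (size_undup_eq (perm_mem p)).
- by rewrite /nilp size_rcons.
- by case=> [|i] //= _; rewrite size_rcons.
- by case=> [|i] //= j _; rewrite size_rcons ltn_mod.
- case=> [|i] _ j j'; last by [].
  rewrite !inE /= size_rcons !ltnS.
  move=> Hj Hj'; rewrite -[j.+1]addn1 -[j'.+1]addn1 => /eqP.
  by rewrite eqn_modDr !modn_small ?ltnS // => /eqP.
- case=> [|i] //= j _; rewrite size_rcons ltnS nth_rcons => Hj.
  case: ltngtP Hj => [Hj _||-> _] //; last by rewrite modnn.
  by rewrite modn_small.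
- by case=> [|i] //= j _ _ _; rewrite size_rcons.
- by move=> k k' _; rewrite addbF.
Qed.

(* Turning a disk over reverses its word and adds a half twist to each band end
   on it, so the bands with both ends on this disk keep their parity. *)
Lemma polyM_rev (T : eqType) (x0 : T) u D (t t' : pred T) :
  {in flatten (u :: D), forall c, count_mem c (flatten (u :: D)) = 2} ->
  {in flatten (u :: D), forall c, t' c = t c (+) odd (count_mem c u)} ->
  polyM (BandSurface (u :: D) t) y z w = polyM (BandSurface (rev u :: D) t') y z w.
Proof.
move=> c2 tt.
have p : perm_eq (rev u ++ flatten D) (u ++ flatten D) by rewrite perm_cat2r perm_rev.
apply: (polyM_iso y z w (x0 := x0) (x0' := x0) (f := id)
  (g := fun i j => if i is 0%N then (size u - j.+1)%N else j)
  (flip := eq_op^~ 0%N) (nm := id)) => //=.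
- exact: (perm_size p).
- exact: (size_undup_eq (perm_mem p)).
- by rewrite /nilp size_rev.
- by case=> [|i] //= _; rewrite size_rev.
- by case=> [|i] //= j _ Hj; rewrite ltn_subrL (leq_trans _ Hj).
- case=> [|i] _ j j'; last by [].
  rewrite !inE /= => Hj Hj' e.
  by apply/succn_inj; rewrite -(subKn Hj) e subKn.
- case=> [|i] //= j _ Hj; rewrite nth_rev; last by rewrite ltn_subrL (leq_trans _ Hj).
  by rewrite subnSK // subKn // ltnW.
- by case.
- case=> [|i] //= j _ Hj _.
  move: (Hj); rewrite leq_eqVlt => /predU1P[<-|Hj2].
    by rewrite modnn subn1 /= modnn subnn.
  by rewrite (modn_small Hj2) subnSK // modn_small // ltn_subrL (leq_trans _ Hj).
- set S := BandSurface (u :: D) t => k k' /andP[kk' /eqP ek].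
  have inS : band_name k \in flatten (u :: D) by apply: band_name_in.
  rewrite tt //; congr (_ (+) _).
  (* The name occurs exactly twice, so the two mates are all its ends; its number of occurrences in
     [u] therefore has the parity of the sum of their flips. *)
  have E : [set h : band_end S | band_name h == band_name k] = [set k; k'].
    apply/esym/eqP; rewrite eqEcard cards2 kk' /=; apply/andP; split.
      by apply/subsetP => h; rewrite !inE => /orP[]/eqP->; rewrite ?eqxx ?ek.
    apply: (@leq_trans (count_mem (band_name k) (flatten (disks S)))); last by rewrite (c2 _ inS).
    rewrite count_disks -sum1_card big_mkcond /=.
    by apply: leq_sum => h _; rewrite inE; case: eqP.
  have -> : count_mem (band_name k) u =
      (\sum_(h in [set k; k']) ((tag h : nat) == 0))%N.
    rewrite -E -[u]/(@disk_word _ S ord0) count_word big_mkcond /= [RHS]big_mkcond /=.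
    apply: eq_bigr => h _; rewrite inE -[tag h == _]/((tag h : nat) == 0%N).
    by case: eqP; case: eqP.
  rewrite big_setU1 ?inE //= big_set1 oddD.
  by do 2!case: (_ == 0)%N.
Qed.

End PolyM.

(** * Naming the strands *)

Definition pairs (F : code) : seq (nat * nat) := flatten (map passes F).

Definition respects (T : Type) (P : seq (nat * nat)) (q : nat -> T) : Prop :=
  forall a b, (a, b) \in P -> q a = q b.

(* [r] names the strands of a diagram with passes [P]: it is a coequalizer of
   the two projections of [P]. *)
Definition strand_names (P : seq (nat * nat)) (r : nat -> nat) : Prop :=
  respects P r /\
  forall p : pred nat, respects P p -> forall x y, r x = r y -> p x = p y.

Lemma respects_cons (T : Type) a b P (q : nat -> T) :
  respects ((a, b) :: P) q <-> q a = q b /\ respects P q.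
Proof.
split=> [H|[e H] c d]; last by rewrite inE => /predU1P[[-> ->]|/H].
by split=> [|c d cd]; apply: H; rewrite inE ?eqxx ?cd ?orbT.
Qed.

(** One pass at a time: a further pass merges two classes by replacing the name [r b] by [r a]. *)
Lemma strand_names_exist P : exists r, strand_names P r.
Proof.
elim: P => [|[a b] P [r [r1 r2]]].
  by exists id; split=> // p _ x y ->.
exists (fun x => if r x == r b then r a else r x); split.
  move=> c d; rewrite inE => /predU1P[[-> ->]|/r1->] //.
  by rewrite eqxx; case: eqP => [->|].
move=> p pP x y.
have pab : p a = p b by apply: pP; rewrite mem_head.
have rp u v : r u = r v -> p u = p v.
  by apply: r2 => c d cd; apply: pP; rewrite inE cd orbT.
by case: eqP => [/rp ex|_]; case: eqP => [/rp ey|_]; [move=> _|move=> /rp e..]; congruence.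
Qed.

(** The universal property is stated for predicates; applied to a fibre of [q], it yields the
    factorization of functions. *)
Lemma strand_names_factor P r (q : nat -> nat) : strand_names P r ->
  (forall a b, (a, b) \in P -> q a = q b) -> forall x y, r x = r y -> q x = q y.
Proof.
move=> [_ r2] qP x y e; apply/eqP; rewrite (r2 (fun u => q u == q y) _ _ _ e) //.
by move=> a b /qP->.
Qed.

Lemma strand_names_eq P r r' : strand_names P r -> strand_names P r' ->
  forall x y, (r x == r y) = (r' x == r' y).
Proof.
move=> rP r'P x y; apply/eqP/eqP; [apply: strand_names_factor rP _ _ _ | ].
  by have [] := r'P.
by apply: strand_names_factor r'P _ _ _; have [] := rP.
Qed.

Lemma passes_ends n a b : (a, b) \in passes n -> a \in ends n /\ b \in ends n.
Proof.
by case: n => [w|s e m f|s e m f|s e|s e] //=; rewrite !inE ?xpair_eqE => H;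
  repeat (case/orP: H => H); case/andP: H => /eqP-> /eqP->; rewrite !eqxx ?orbT.
Qed.

Lemma pairs_arcs F a b : (a, b) \in pairs F -> a \in arcs F /\ b \in arcs F.
Proof.
case/flattenP=> _ /mapP[n nF ->] /passes_ends[ha hb].
by split; apply/flattenP; exists (ends n); rewrite ?map_f.
Qed.

Lemma vertices_arcs F w : w \in vertices F -> {subset w <= arcs F}.
Proof.
rewrite /vertices mem_pmap => /mapP[[] // v vF [->]] x xv.
by apply/flattenP; exists v => //; apply: (map_f ends vF).
Qed.

Definition named_vertices (F : code) (r : nat -> nat) := map (map r) (vertices F).
Definition named_bars (F : code) (r : nat -> nat) (c : nat) : nat :=
  count (fun n => if n is Bar a _ then r a == c else false) F.

(** * The polynomial Q in terms of named strands *)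

Section NamedQ.
Variables (K : comNzRingType) (y z w : K).

(** When [L] lists the names of all arcs, a name outside [flatten W] belongs to a strand that
    reaches no vertex, that is, to a circle component. *)
Definition nb_free (W : seq (seq nat)) (L : seq nat) (t : pred nat) : nat :=
  size (undup [seq c <- L | (c \notin flatten W) && t c]).

Definition subwords (W : seq (seq nat)) (X : {fset nat}) :=
  [seq [seq c <- u | c \in X] | u <- W].

(* The polynomial [polyQ] in terms of the words [W] of the vertices and of the
   list [L] of all strands, the strands being named by natural numbers. *)
Definition namedQ (W : seq (seq nat)) (L : seq nat) (t : pred nat) : K :=
  (- 1 - y) ^+ nb_free W L (predC t) * (- 1 - y * z * w) ^+ nb_free W L t
  * \sum_(X <- fpowerset [fset c in flatten W]%fset)
      polyM (BandSurface (subwords W X) t) y z w.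

(** The parities are compared directly on circle components only: on edges, a change of parity may
    be compensated by a change of the words, as happens in T4. *)
Lemma eq_namedQ W L t W' L' t' :
  L =i L' -> flatten W =i flatten W' ->
  {in L, forall c, c \notin flatten W -> t c = t' c} ->
  (forall X, polyM (BandSurface (subwords W X) t) y z w =
             polyM (BandSurface (subwords W' X) t') y z w) ->
  namedQ W L t = namedQ W' L' t'.
Proof.
move=> eL eW et eM; rewrite /namedQ.
have eF : [fset c in flatten W]%fset = [fset c in flatten W']%fset.
  by apply/fsetP=> c; rewrite !inE /= eW.
have N u u' : {in L, forall c, c \notin flatten W -> u c = u' c} ->
    nb_free W L u = nb_free W' L' u'.
  move=> uu; apply: size_undup_eq => c; rewrite !mem_filter -eW -eL.
  have [cL|] := boolP (c \in L); last by rewrite !andbF.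
  by have [cW|cW] := boolP (c \in flatten W); rewrite //= uu.
congr (_ ^+ _ * _ ^+ _ * _); [apply: N => c cL cW /= | exact: N |].
  by rewrite et.
by rewrite eF; apply: eq_bigr.
Qed.

Section Names.
Variables (F : code) (r : nat -> nat).
Hypothesis rP : strand_names (pairs F) r.

(** The naming is constant along adjacent arcs. Conversely, being reachable from [x] is a predicate
    that respects the passes, so the universal property makes it constant on the fibres of [r]. *)
Let mem_strand (x : nat) (u : arc F) : x \in arcs F -> (u \in strand F x) = (r x == r (ssval u)).
Proof.
move=> xF; rewrite inE; apply/existsP/eqP.
  case=> x' /andP[/eqP<- c].
  have cl : closed (@arc_adj F) [pred v | r (ssval v) == r (ssval x')].
    move=> v v' /orP[] /rP.1; rewrite !inE => ->; done.
  by have := closed_connect cl c; rewrite !inE eqxx => /esym/eqP.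
move=> e; pose x' : arc F := SeqSub xF.
pose p v := [exists v' : arc F, (ssval v' == v) && connect (@arc_adj F) x' v'].
have sym := sym_connect_sym (fun v v' : arc F => orbC _ _ : arc_adj v v' = arc_adj v' v).
have pP a b : (a, b) \in pairs F -> p a = p b.
  move=> ab; have [aF bF] := pairs_arcs ab.
  have cab : connect (@arc_adj F) (SeqSub aF) (SeqSub bF).
    by apply: connect1; rewrite /arc_adj /= -/(pairs F) ab.
  apply/existsP/existsP => -[v' /andP[/eqP ev c]].
    have ev' : v' = SeqSub aF by apply: val_inj.
    by exists (SeqSub bF); rewrite eqxx (connect_trans c) // ev'.
  have ev' : v' = SeqSub bF by apply: val_inj.
  by exists (SeqSub aF); rewrite eqxx (connect_trans c) // ev' sym.
have : p x by apply/existsP; exists x'; rewrite eqxx connect0.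
rewrite (rP.2 p pP _ _ e) => /existsP[u' /andP[/eqP/val_inj-> c]].
by exists x'; rewrite eqxx c.
Qed.

Let strand_eq x x' : x \in arcs F -> x' \in arcs F ->
  (strand F x == strand F x') = (r x == r x').
Proof.
move=> xF x'F; apply/eqP/eqP => e.
  have : (SeqSub xF : arc F) \in strand F x by rewrite mem_strand.
  by rewrite e mem_strand // => /eqP.
by apply/setP => u; rewrite !mem_strand // e.
Qed.

(** The default is never met on the strand of an arc, since this set contains the arc. *)
Let name (C : {set arc F}) : nat := if [pick u in C] is Some u then r (ssval u) else 0%N.

Let name_strand x : x \in arcs F -> name (strand F x) = r x.
Proof.
move=> xF; rewrite /name; case: pickP => [u|/(_ (SeqSub xF))].
  by rewrite mem_strand // => /eqP.
by rewrite mem_strand //= eqxx.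
Qed.

Let edgeP C : reflect (exists2 x, x \in flatten (vertices F) & C = strand F x) (C \in edges F).
Proof. by rewrite inE; apply: (iffP mapP). Qed.

Let vert_arcs x : x \in flatten (vertices F) -> x \in arcs F.
Proof. by case/flattenP=> u /vertices_arcs H /H. Qed.

Let name_edge C : C \in edges F -> name C \in flatten (named_vertices F r).
Proof.
by case/edgeP=> x xV ->; rewrite name_strand ?vert_arcs // -map_flatten map_f.
Qed.

Let all_name_inj : {in [set:: map (strand F) (arcs F)] &, injective name}.
Proof.
move=> C C'; rewrite !inE => /mapP[x xF ->] /mapP[x' x'F ->].
by rewrite !name_strand // => /eqP; rewrite -strand_eq // => /eqP.
Qed.

Let edge_all C : C \in edges F -> C \in [set:: map (strand F) (arcs F)].
Proof. by case/edgeP=> x /vert_arcs xF ->; rewrite inE map_f. Qed.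

Let name_inj : {in edges F &, injective name}.
Proof. by move=> C C' /edge_all CF /edge_all C'F; apply: all_name_inj. Qed.

Let bars_strand x : x \in arcs F -> bars (strand F x) = named_bars F r (r x).
Proof.
move=> xF; apply: eq_in_count => -[] // a b nF; rewrite strand_eq //.
by apply/flattenP; exists [:: a; b]; rewrite ?mem_head //; apply: (map_f ends nF).
Qed.

Let nb_circles (t : pred {set arc F}) (t' : pred nat) :
  (forall x, x \in arcs F -> t (strand F x) = t' (r x)) ->
  #|[set C in circles F | t C]| = nb_free (named_vertices F r) (map r (arcs F)) t'.
Proof.
move=> tt; rewrite cardE -(size_map name); apply/perm_size/uniq_perm.
- rewrite map_inj_in_uniq ?enum_uniq // => C C'.
  rewrite !mem_enum !inE => /andP[/andP[_ CF] _] /andP[/andP[_ C'F] _].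
  by apply: all_name_inj; rewrite inE.
- exact: undup_uniq.
move=> c; rewrite mem_undup mem_filter.
have E x : x \in arcs F -> (strand F x \in edges F) = (r x \in flatten (named_vertices F r)).
  move=> xF; rewrite -map_flatten; apply/edgeP/mapP => -[x' x'V e]; exists x' => //.
    by apply/eqP; rewrite -(strand_eq xF (vert_arcs x'V)); apply/eqP.
  by apply/eqP; rewrite (strand_eq xF (vert_arcs x'V)); apply/eqP.
apply/mapP/idP => [[C]|/andP[/andP[cV tc] /mapP[x xF ex]]].
  rewrite mem_enum inE => /andP[/setDP[]]; rewrite inE => /mapP[x xF ->].
  by rewrite E // name_strand // tt // => h1 h2 ->; rewrite h1 h2 map_f.
exists (strand F x); last by rewrite name_strand.
by rewrite mem_enum inE tt // -ex tc andbT inE E // -ex cV inE map_f.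
Qed.

Lemma polyQ_named : polyQ F y z w =
  namedQ (named_vertices F r) (map r (arcs F)) (fun c => odd (named_bars F r c)).
Proof.
rewrite /polyQ /namedQ /nb_even_circles /nb_odd_circles.
rewrite (@nb_circles _ (predC (fun c => odd (named_bars F r c)))); last first.
  by move=> x xF /=; rewrite bars_strand.
rewrite (@nb_circles _ (fun c => odd (named_bars F r c))); last first.
  by move=> x xF /=; rewrite bars_strand.
congr (_ * _).
(* Naming the members of a set of edges gives a bijection from the subsets of [edges F] onto the
   index set of the sum in [namedQ]. *)
pose nameS (A : {set {set arc F}}) := [fset c in map name (enum A)]%fset.
have nameSP (A : {set {set arc F}}) : A \subset edges F ->
    {in edges F, forall C, (name C \in nameS A) = (C \in A)}.
  move=> AE C CE; rewrite inE /=; apply/mapP/idP => [[C']|CA]; last first.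
    by exists C; rewrite // mem_enum.
  rewrite mem_enum => C'A /name_inj -> //; exact: (subsetP AE).
rewrite -big_enum /=.
have p : perm_eq (map nameS (enum (powerset (edges F))))
                 (fpowerset [fset c in flatten (named_vertices F r)]%fset).
  apply: uniq_perm; rewrite ?fset_uniq //.
    rewrite map_inj_in_uniq ?enum_uniq // => A B; rewrite !mem_enum !inE => AE BE e.
    apply/setP=> C; have [CE|CE] := boolP (C \in edges F).
      by rewrite -(nameSP A) // e nameSP.
    by rewrite (contraNF (subsetP AE C) CE) (contraNF (subsetP BE C) CE).
  move=> X; rewrite fpowersetE; apply/mapP/fsubsetP => [[A]|XE].
    rewrite mem_enum inE => AE -> c; rewrite !inE /= => /mapP[C]; rewrite mem_enum => CA ->.
    exact/name_edge/(subsetP AE).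
  have AE : [set C in edges F | name C \in X] \subset edges F.
    by apply/subsetP=> C; rewrite inE => /andP[].
  exists [set C in edges F | name C \in X]; first by rewrite mem_enum inE.
  apply/fsetP=> c; apply/idP/idP => [cX|].
    have := XE c cX; rewrite inE /= -map_flatten => /mapP[x xV ec].
    have xE : strand F x \in edges F by apply/edgeP; exists x.
    have en : name (strand F x) = c by rewrite name_strand ?vert_arcs.
    by rewrite -en nameSP // inE xE en.
  by rewrite inE /= => /mapP[C]; rewrite mem_enum inE => /andP[_ nX] ->.
rewrite -(perm_big _ p) big_map; apply: eq_big_seq => A; rewrite mem_enum inE => AE.
have sub : {subset flatten (disks (surface A)) <= edges F}.
  move=> C /flattenP[_ /mapP[u uV ->]]; rewrite mem_filter => /andP[CA _].
  exact: (subsetP AE).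
rewrite (polyM_map y z w set0 0%N (h := name)
   (t' := fun c => odd (named_bars F r c))); first last.
- by move=> C /sub/edgeP[x xV ->]; rewrite name_strand ?bars_strand ?vert_arcs.
- by move=> C C' /sub CE /sub C'E; apply: name_inj.
congr (polyM (BandSurface _ _) _ _ _).
rewrite /subwords /named_vertices -!map_comp; apply/eq_in_map => u uV /=.
rewrite !filter_map -map_comp.
have inV x : x \in u -> x \in flatten (vertices F) by move=> xu; apply/flattenP; exists u.
rewrite (_ : filter _ u = [seq x <- u | r x \in nameS A]); last first.
  apply: eq_in_filter => x /inV xV /=.
  by rewrite -(name_strand (vert_arcs xV)) nameSP //; apply/edgeP; exists x.
by apply/eq_in_map => x; rewrite mem_filter => /andP[_ /inV/vert_arcs/name_strand].
Qed.

End Names.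
End NamedQ.

(** * Strand names under changes of the code *)

Lemma strand_names_ext P P' r :
  (forall (T : Type) (q : nat -> T), respects P q <-> respects P' q) ->
  strand_names P r -> strand_names P' r.
Proof.
move=> PP' [r1 r2]; split; first exact/PP'.
by move=> p pP'; apply: r2; apply/PP'.
Qed.

Lemma respects_eq_mem (T : Type) P P' (q : nat -> T) :
  P =i P' -> respects P q <-> respects P' q.
Proof. by move=> e; split=> H a b ab; apply: H; rewrite ?e // -e. Qed.

Lemma pairs_relabel f F :
  pairs (map (relabel f) F) = [seq (f p.1, f p.2) | p <- pairs F].
Proof. by rewrite /pairs map_flatten -!map_comp; congr flatten; apply: eq_map => -[]. Qed.

Lemma arcs_relabel f F : arcs (map (relabel f) F) = map f (arcs F).
Proof. by rewrite /arcs map_flatten -!map_comp; congr flatten; apply: eq_map => -[]. Qed.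

Lemma vertices_relabel f F : vertices (map (relabel f) F) = map (map f) (vertices F).
Proof. by elim: F => //= -[w|????|????|??|??] F IH //=; rewrite -IH. Qed.

Lemma vertices_cat F F' : vertices (F ++ F') = vertices F ++ vertices F'.
Proof. exact: pmap_cat. Qed.

Lemma pairs_cat F F' : pairs (F ++ F') = pairs F ++ pairs F'.
Proof. by rewrite /pairs map_cat flatten_cat. Qed.

Lemma arcs_cat F F' : arcs (F ++ F') = arcs F ++ arcs F'.
Proof. by rewrite /arcs map_cat flatten_cat. Qed.

Lemma named_bars_cat F F' r c :
  named_bars (F ++ F') r c = (named_bars F r c + named_bars F' r c)%N.
Proof. exact: count_cat. Qed.

Lemma named_vertices_relabel f F r :
  named_vertices (map (relabel f) F) r = named_vertices F (r \o f).
Proof.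
rewrite /named_vertices vertices_relabel -map_comp.
by apply: eq_map => u; rewrite /= -map_comp.
Qed.

Lemma named_bars_relabel f F r c : named_bars (map (relabel f) F) r c = named_bars F (r \o f) c.
Proof. by rewrite /named_bars count_map; apply: eq_count => -[]. Qed.

Lemma strand_names_relabel f P r : injective f ->
  strand_names [seq (f p.1, f p.2) | p <- P] r -> strand_names P (r \o f).
Proof.
move=> fI [r1 r2]; split=> [a b ab|p pP x y /= e].
  by apply: r1; apply/mapP; exists (a, b).
(* Since [f] need not be surjective, [p] is transported along [f] and extended by false outside its
   image. *)
pose p' u := `[< exists2 v, f v = u & p v >].
have p'f v : p' (f v) = p v.
  by apply/asboolP/idP => [[v' /fI->]|pv] //; exists v.
rewrite -!p'f; apply: r2 e => _ _ /mapP[[a b] ab [-> ->]] /=.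
by rewrite !p'f; apply: pP.
Qed.

Definition merge (a b x : nat) : nat := if x == b then a else x.

(** The quotient is taken in two stages: [a] and [b] are identified, and then the images of the
    other passes are. *)
Lemma strand_names_merge a b P r :
  strand_names [seq (merge a b p.1, merge a b p.2) | p <- P] r ->
  strand_names ((a, b) :: P) (r \o merge a b).
Proof.
move=> [r1 r2]; split.
  apply/respects_cons; split=> [|c d cd] /=; first by rewrite /merge eqxx; case: ifP.
  by apply: r1; apply/mapP; exists (c, d).
move=> p /respects_cons[pab pP] x y /= e.
have pm u : p (merge a b u) = p u by rewrite /merge; case: eqP => // ->.
rewrite -(pm x) -(pm y); apply: r2 e => _ _ /mapP[[c d] cd [-> ->]] /=.
by rewrite !pm; apply: pP.
Qed.

(** * Every strand that reaches a vertex has two ends *)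

Definition doubled (L : seq nat) : Prop := {in L, forall x, count_mem x L = 2}.

Lemma doubled_perm L L' : perm_eq L L' -> doubled L -> doubled L'.
Proof. by move=> p d x; rewrite -(perm_mem p) -(permP p); apply: d. Qed.

Lemma well_formedP F : reflect (doubled (arcs F)) (well_formed F).
Proof. by apply: (iffP allP) => H x /H; [move/eqP | move->]. Qed.

(** The two listed ends disappear; the remaining end of [a] and the remaining end of [b] become the
    two ends of the merged arc. *)
Lemma doubled_merge a b L : a != b -> doubled [:: a, b & L] -> doubled (map (merge a b) L).
Proof.
move=> ab d.
have ca : count_mem a L = 1%N.
  by have := d a; rewrite mem_head /= eqxx [b == a]eq_sym (negPf ab) => /(_ isT)[].
have cb : count_mem b L = 1%N.
  by have := d b; rewrite !inE /= !eqxx orbT (negPf ab) => /(_ isT)[].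
move=> _ /mapP[x xL ->]; rewrite count_map.
have [e|ne] := eqVneq (merge a b x) a.
  rewrite e (@eq_count _ _ (predU (pred1 a) (pred1 b))).
    have := count_predUI (pred1 a) (pred1 b) L; rewrite ca cb.
    rewrite (@eq_count _ (predI _ _) pred0) ?count_pred0 ?addn0 // => u /=.
    by case: eqP => // ->; apply/negbTE.
  by move=> u /=; rewrite /merge; case: (eqVneq u b) => [->|]; rewrite ?eqxx ?orbT ?orbF.
have xb : x != b by apply: contraNneq ne => ->; rewrite /merge eqxx.
have ex : merge a b x = x by rewrite /merge (negPf xb).
rewrite ex in ne *.
have := d x; rewrite !inE xL !orbT /= [a == x]eq_sym [b == x]eq_sym (negPf ne) (negPf xb).
move=> <- //; apply: eq_count => u /=; rewrite /merge; case: (eqVneq u b) => // ->.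
by rewrite [a == x]eq_sym [b == x]eq_sym (negPf ne) (negPf xb).
Qed.

Definition pair_ends (P : seq (nat * nat)) : seq nat := flatten [seq [:: p.1; p.2] | p <- P].

Lemma map_pair_ends f P : map f (pair_ends P) = pair_ends [seq (f p.1, f p.2) | p <- P].
Proof. by rewrite /pair_ends map_flatten -!map_comp. Qed.

Lemma count_strand_ends P V r : strand_names P r -> doubled (V ++ pair_ends P) ->
  {in V, forall x, count (fun v => r v == r x) V = 2}.
Proof.
elim: {P}(size P) {-2}P (leqnn (size P)) V r => [|n IH] [|[a b] P] //= leP V r rP d x xV.
(* Without passes every predicate respects [P], so [r] separates distinct arcs. *)
- rewrite /pair_ends /= cats0 in d; rewrite -(d x xV); apply: eq_count => v /=.
  apply/eqP/eqP => [e|-> //]; apply/eqP.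
  by rewrite -[v == x]/(pred1 x v) (rP.2 (pred1 x) _ v x e) /= ?eqxx.
- by have := IH [::] isT V r rP d x xV.
have [eab|ab] := eqVneq a b.
  subst b; have caV : a \notin V.
    apply/negP => aV; have := d a; rewrite count_cat mem_cat aV /= eqxx => /(_ isT).
    by move: aV; rewrite -has_pred1 has_count; case: (count_mem a V) => [//|k]; lia.
  have caP : a \notin pair_ends P.
    apply/negP => aP; have := d a; rewrite count_cat mem_cat inE eqxx orbT /= eqxx => /(_ isT).
    by move: aP; rewrite -has_pred1 has_count; case: (count_mem a (pair_ends P)) => [//|k]; lia.
  apply: (IH P leP V r) => //.
    apply: (strand_names_ext _ rP) => T q; rewrite respects_cons.
    by split=> [[]|].
  move=> u uL; have ua : a == u = false.
    apply/negP => /eqP e; move: uL; rewrite mem_cat -e.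
    by rewrite (negPf caV) (negPf caP).
  move: (d u); rewrite !count_cat /= ua; apply.
  by move: uL; rewrite !mem_cat !inE => /orP[]->; rewrite ?orbT.
(* Contracting the passage [(a, b)] keeps the list doubled. *)
have [r' r'P] := strand_names_exist [seq (merge a b p.1, merge a b p.2) | p <- P].
have rr' := strand_names_eq rP (strand_names_merge r'P).
have d' : doubled (map (merge a b) V ++ pair_ends [seq (merge a b p.1, merge a b p.2) | p <- P]).
  rewrite -map_pair_ends -map_cat; apply: doubled_merge => //.
  apply: doubled_perm d; rewrite -[[:: a, b & V ++ _]]/([:: a; b] ++ V ++ _) perm_catCA.
  by rewrite perm_cat2l.
have := IH _ _ _ r' r'P d' (merge a b x) (map_f _ xV).
rewrite size_map count_map => /(_ leP) <-.
by apply: eq_count => v /=; rewrite rr'.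
Qed.

Definition pure (F : code) : bool := ~~ has is_classical F.

Lemma perm_arcs F : pure F -> perm_eq (arcs F) (flatten (vertices F) ++ pair_ends (pairs F)).
Proof.
elim: F => //= n F IH; rewrite /pure /= negb_or => /andP[nC /IH p].
rewrite /arcs /pairs /= -/(arcs F) -/(pairs F) /pair_ends map_cat flatten_cat.
rewrite -!/(pair_ends _).
case: n nC => //= [u _|a b c d _|a b _|a b _].
- by rewrite -catA perm_cat2l.
- rewrite -[flatten _ ++ _]/(flatten (vertices F) ++ [:: a; c; b; d] ++ pair_ends (pairs F)).
  rewrite perm_sym perm_catCA perm_sym.
  rewrite -[X in perm_eq X _]/([:: a; b; c; d] ++ arcs F); apply: perm_cat => //.
  by apply/permP => q /=; rewrite !addn0; congr (_ + _)%N; rewrite addnCA.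
- rewrite -[flatten _ ++ _]/(flatten (vertices F) ++ [:: a; b] ++ pair_ends (pairs F)).
  by rewrite perm_sym perm_catCA perm_sym (perm_cat2l [:: a; b]).
- rewrite -[flatten _ ++ _]/(flatten (vertices F) ++ [:: a; b] ++ pair_ends (pairs F)).
  by rewrite perm_sym perm_catCA perm_sym (perm_cat2l [:: a; b]).
Qed.

Lemma count_named_vertices F r : pure F -> doubled (arcs F) -> strand_names (pairs F) r ->
  {in flatten (named_vertices F r), forall c, count_mem c (flatten (named_vertices F r)) = 2}.
Proof.
move=> pF d rP c; rewrite -map_flatten => /mapP[x xV ->]; rewrite count_map.
by apply: (count_strand_ends rP) => //; apply: doubled_perm d; apply: perm_arcs.
Qed.

(** * Invariance of Q *)

Definition points (P : seq (nat * nat)) : code := [seq Point p.1 p.2 | p <- P].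
Definition bar_points (P : seq (nat * nat)) : code := [seq Bar p.1 p.2 | p <- P].

Lemma pairs_points P : pairs (points P) = P.
Proof. by elim: P => //= -[a b] P IH; rewrite /pairs /= -/(pairs _) IH. Qed.

Lemma pairs_bar_points P : pairs (bar_points P) = P.
Proof. by elim: P => //= -[a b] P IH; rewrite /pairs /= -/(pairs _) IH. Qed.

Lemma arcs_points P : arcs (points P) = pair_ends P.
Proof. by rewrite /arcs /pair_ends -map_comp. Qed.

Lemma arcs_bar_points P : arcs (bar_points P) = pair_ends P.
Proof. by rewrite /arcs /pair_ends -map_comp. Qed.

Lemma vertices_points P : vertices (points P) = [::].
Proof. by elim: P. Qed.

Lemma vertices_bar_points P : vertices (bar_points P) = [::].
Proof. by elim: P. Qed.

Lemma named_bars_points P r c : named_bars (points P) r c = 0%N.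
Proof. by elim: P. Qed.

Lemma named_bars_bar_points P r c :
  named_bars (bar_points P) r c = count_mem c [seq r p.1 | p <- P].
Proof. by rewrite /named_bars !count_map; apply: eq_count. Qed.

Section PureMoves.
Variables (K : comNzRingType) (y z w : K).
Local Notation Q F := (polyQ F y z w).

Lemma polyQ_perm F F' : perm_eq F F' -> Q F = Q F'.
Proof.
move=> p; have [r rP] := strand_names_exist (pairs F).
have pp : perm_eq (pairs F) (pairs F') by apply/perm_flatten/perm_map.
have r'P : strand_names (pairs F') r.
  by apply: strand_names_ext rP => T q; apply/respects_eq_mem/perm_mem.
have pW : perm_eq (named_vertices F r) (named_vertices F' r).
  by apply/perm_map/perm_pmap.
rewrite (polyQ_named y z w rP) (polyQ_named y z w r'P); apply: eq_namedQ.
- by apply/perm_mem/perm_map/perm_flatten/perm_map.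
- exact/perm_mem/perm_flatten.
- by move=> c _ _; rewrite /named_bars (permP p).
- move=> X; rewrite (polyM_perm y z w 0%N _ (perm_map _ pW)).
  by apply: (eq_polyM _ _ _ 0%N) => c _; rewrite /named_bars (permP p).
Qed.

(** This covers all changes that affect neither the vertices nor the strands: T1, T2, and the
    rotations of virtual crossings, bars and points. *)
Lemma polyQ_same_strands F F' :
  vertices F = vertices F' -> arcs F =i arcs F' ->
  (forall (T : Type) (q : nat -> T), respects (pairs F) q <-> respects (pairs F') q) ->
  (forall r, respects (pairs F) r ->
     forall c, odd (named_bars F r c) = odd (named_bars F' r c)) ->
  Q F = Q F'.
Proof.
move=> eV eA eP eB; have [r rP] := strand_names_exist (pairs F).
have r'P : strand_names (pairs F') r by apply: strand_names_ext rP.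
rewrite (polyQ_named y z w rP) (polyQ_named y z w r'P) /named_vertices eV.
apply: eq_namedQ => // [|c _ _|X].
- by apply: eq_mem_map.
- by apply: eB; case: rP.
- by apply: (eq_polyM _ _ _ 0%N) => c _; rewrite eB //; case: rP.
Qed.

Lemma polyQ_rotate_vertex a u s : Q (Vertex (a :: u) :: s) = Q (Vertex (rcons u a) :: s).
Proof.
have [r rP] := strand_names_exist (pairs s).
rewrite (@polyQ_named _ y z w (Vertex _ :: s) r rP).
rewrite (@polyQ_named _ y z w (Vertex (rcons _ _) :: s) r rP).
have pu : perm_eq (rcons u a) (a :: u) by rewrite perm_rcons.
apply: eq_namedQ => // [||X].
- apply/perm_mem/perm_map; rewrite /arcs /= -/(arcs s).
  by rewrite -cat_cons perm_cat2r perm_sym.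
- apply/perm_mem; rewrite /= -cat_cons perm_cat2r -map_cons perm_sym.
  exact: perm_map.
rewrite /subwords /= map_rcons filter_rcons; case: ifP => // _.
by rewrite polyM_rot.
Qed.

Lemma polyQ_relabel f F : injective f -> Q (map (relabel f) F) = Q F.
Proof.
move=> fI; have [r rP] := strand_names_exist (pairs (map (relabel f) F)).
have r'P : strand_names (pairs F) (r \o f).
  by apply: strand_names_relabel => //; rewrite -pairs_relabel.
rewrite (polyQ_named y z w rP) (polyQ_named y z w r'P).
rewrite named_vertices_relabel arcs_relabel -map_comp.
apply: eq_namedQ => // [c _ _|X]; first by rewrite named_bars_relabel.
by apply: (eq_polyM _ _ _ 0%N) => c _; rewrite named_bars_relabel.
Qed.

(** The hypothesis ensures that the merged strand still has an arc in [s]: a point that closes up a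
    circle by itself is the only trace of this circle. *)
Lemma polyQ_merge a b s : a \in map (merge a b) (arcs s) ->
  Q (Point a b :: s) = Q (map (relabel (merge a b)) s).
Proof.
move=> aS; have [r rP] := strand_names_exist (pairs (map (relabel (merge a b)) s)).
have r'P : strand_names (pairs (Point a b :: s)) (r \o merge a b).
  by apply: strand_names_merge; rewrite -pairs_relabel.
rewrite (polyQ_named y z w rP) (polyQ_named y z w r'P).
rewrite named_vertices_relabel arcs_relabel -map_comp.
apply: eq_namedQ => // [c|c _ _|X].
- have rs : r a \in [seq (r \o merge a b) i | i <- arcs s].
    by case/mapP: aS => x xs ea; apply/mapP; exists x; rewrite /= -?ea.
  have ma : merge a b a = a by rewrite /merge; case: ifP.
  have mb : merge a b b = a by rewrite /merge eqxx.
  rewrite /arcs /= -/(arcs s) !inE ma mb orbA orbb.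
  by case: eqP => [->|]; rewrite ?rs.
- by rewrite named_bars_relabel.
- by apply: (eq_polyM _ _ _ 0%N) => c _; rewrite named_bars_relabel.
Qed.

Lemma polyQ_virtual ns s : {subset ns <= [pred n | if n is Virtual _ _ _ _ then true else false]} ->
  Q (ns ++ s) = Q (points (pairs ns) ++ s).
Proof.
move=> nsV.
have [vV [aV bV]] : vertices ns = [::] /\ (arcs ns =i pair_ends (pairs ns)
    /\ forall r c, named_bars ns r c = 0%N).
  elim: ns nsV => // n ns IH nsV.
  have [|eV [ea bV]] := IH; first by move=> m mn; apply: nsV; rewrite inE mn orbT.
  have := nsV n (mem_head _ _); case: n nsV => // a b c d _ _.
  split=> //; split=> // x.
  rewrite -[arcs _]/([:: a; b; c; d] ++ arcs ns).
  rewrite -[pair_ends (pairs _)]/([:: a; c; b; d] ++ pair_ends (pairs ns)).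
  by rewrite !mem_cat ea !inE; case: (x == a); case: (x == b); case: (x == c).
apply: polyQ_same_strands.
- by rewrite !vertices_cat vV vertices_points.
- by move=> x; rewrite !arcs_cat !mem_cat aV arcs_points.
- by move=> T q; rewrite !pairs_cat pairs_points.
- by move=> r _ c; rewrite !named_bars_cat bV named_bars_points.
Qed.

(** Removing one bar next to each end at the vertex toggles a strand as often as its name occurs in
    the vertex word, which is the correction of the twists in [polyM_rev]. Passing to a spanning
    subgraph keeps all occurrences of the chosen names, and circle components do not meet the
    vertex. *)
Lemma polyQ_flip top bot s : size top = size bot -> pure s ->
  doubled (arcs (Vertex bot :: bar_points (zip top bot) ++ s)) ->
  Q (Vertex bot :: bar_points (zip top bot) ++ s) =
  Q (Vertex (rev bot) :: points (zip top bot) ++ s).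
Proof.
move=> sz ps d; set P := zip top bot.
have pF : pure (Vertex bot :: bar_points P ++ s).
  by rewrite /pure /= has_cat negb_or -/(pure s) ps andbT; elim: (P).
have [r rP] := strand_names_exist (P ++ pairs s).
have r1 : strand_names (pairs (Vertex bot :: bar_points P ++ s)) r.
  by rewrite -[pairs _]/(pairs (bar_points P ++ s)) pairs_cat pairs_bar_points.
have r2 : strand_names (pairs (Vertex (rev bot) :: points P ++ s)) r.
  by rewrite -[pairs _]/(pairs (points P ++ s)) pairs_cat pairs_points.
have c2 := count_named_vertices pF d r1.
have bE c : odd (named_bars (Vertex (rev bot) :: points P ++ s) r c) =
    odd (named_bars (Vertex bot :: bar_points P ++ s) r c) (+) odd (count_mem c (map r bot)).
  rewrite -[named_bars (Vertex (rev _) :: _) _ _]/(named_bars (points P ++ s) r c).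
  rewrite -[named_bars (Vertex bot :: _) _ _]/(named_bars (bar_points P ++ s) r c).
  rewrite !named_bars_cat named_bars_points named_bars_bar_points add0n oddD.
  have -> : [seq r p.1 | p <- P] = map r bot.
    rewrite -[in RHS](@unzip2_zip _ _ top bot) ?sz // -map_comp -/P.
    apply/eq_in_map => -[a b] ab /=; apply: rP.1; by rewrite mem_cat ab.
  by rewrite addbAC addbb.
rewrite (polyQ_named y z w r1) (polyQ_named y z w r2).
have eW : named_vertices (Vertex bot :: bar_points P ++ s) r = map r bot :: named_vertices s r.
  by rewrite /named_vertices /= -/(vertices _) vertices_cat vertices_bar_points.
have eW' : named_vertices (Vertex (rev bot) :: points P ++ s) r =
    rev (map r bot) :: named_vertices s r.
  by rewrite /named_vertices /= -/(vertices _) vertices_cat vertices_points map_rev.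
rewrite eW in c2 *; rewrite eW'; apply: eq_namedQ => [c|c|c _ cW|X].
- apply: eq_mem_map => x; rewrite -[arcs (_ :: _)]/(bot ++ arcs (bar_points P ++ s)).
  rewrite -[arcs (Vertex (rev _) :: _)]/(rev bot ++ arcs (points P ++ s)).
  by rewrite !arcs_cat arcs_points arcs_bar_points !mem_cat mem_rev.
- by rewrite /= !mem_cat mem_rev.
- rewrite bE (_ : count_mem c _ = 0%N) ?addbF //; apply/count_memPn.
  by apply: contra cW; rewrite /= mem_cat => ->.
rewrite /subwords /= filter_rev; apply: (polyM_rev _ _ _ 0%N).
- move=> c; rewrite -[_ :: _]/(subwords (map r bot :: named_vertices s r) X).
  rewrite /subwords -filter_flatten mem_filter => /andP[cX cW].
  rewrite count_filter (@eq_in_count _ _ (pred1 c)) ?c2 // => x _ /=.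
  by case: eqP => // ->; rewrite cX.
- move=> c; rewrite -[_ :: _]/(subwords (map r bot :: named_vertices s r) X).
  rewrite /subwords -filter_flatten mem_filter => /andP[cX cW].
  rewrite bE; congr (_ (+) odd _); rewrite count_filter; apply: eq_count => x /=.
  by case: eqP => // ->; rewrite cX.
Qed.
End PureMoves.

(* [chain top P w]: following the strands that start at the arcs [top] through
   the passes [P], taken in this order, one arrives at the arcs [w]. *)
Inductive chain : seq nat -> seq (nat * nat) -> seq nat -> Prop :=
  | chain_nil top w of perm_eq top w : chain top [::] w
  | chain_cons top a b T P w of
      perm_eq top (a :: T) & chain (b :: T) P w : chain top ((a, b) :: P) w.

Lemma perm_cons_cat (T : eqType) (x : T) s t : perm_eq (x :: s ++ t) (s ++ x :: t).
Proof. by rewrite -[x :: s ++ t]/([:: x] ++ s ++ t) perm_catCA. Qed.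

Lemma chain_perml top top' P w : perm_eq top' top -> chain top P w -> chain top' P w.
Proof.
move=> p c; case: c p => [t u tu|t a b T R u tT c] p.
  exact/chain_nil/(perm_trans p).
exact: chain_cons (perm_trans p tT) c.
Qed.

Lemma chain_permr top P w w' : perm_eq w w' -> chain top P w -> chain top P w'.
Proof.
move=> p c; elim: c p => {top P w} [t u tu|t a b T R u tT _ IH] p.
  exact/chain_nil/(perm_trans tu).
exact: chain_cons tT (IH p).
Qed.

Lemma chain_map f top P w :
  chain top P w -> chain (map f top) [seq (f p.1, f p.2) | p <- P] (map f w).
Proof.
elim=> {top P w} [t u tu|t a b T R u tT _ IH] /=; first exact/chain_nil/perm_map.
by apply: chain_cons IH; apply: (perm_map f tT).
Qed.

(** Conservation of arcs: an arc that is present at the start or entered by a pass is either left by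
    a later pass or present at the end. *)
Lemma perm_chain top P w : chain top P w -> perm_eq (unzip1 P ++ w) (top ++ unzip2 P).
Proof.
elim=> {top P w} [t u tu|t a b T R u tT _ IH] /=; first by rewrite cats0 perm_sym.
apply/permP => q; have /permP/(_ q) := IH; have /permP/(_ q) := tT.
by rewrite /= !count_cat /=; lia.
Qed.

Lemma chain_zip top bot : size top = size bot -> chain top (zip top bot) bot.
Proof.
(* The statement is generalized over a list that collects the arcs at which the strands already
   followed have arrived. *)
move=> e; rewrite -[top in chain top]cats0 -[X in chain _ _ X]cats0.
elim: top bot e [::] => [|a top IH] [|b bot] //=; first by move=> _ X; apply: chain_nil.
move=> [e] X.
apply: (chain_cons (T := top ++ X)) => //.
apply: (chain_perml (top := top ++ b :: X)).
  exact: perm_cons_cat.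
apply: (chain_permr (w := bot ++ b :: X)); last exact: IH.
by rewrite perm_sym; apply: perm_cons_cat.
Qed.

Lemma perm_pair_ends P : perm_eq (pair_ends P) (unzip1 P ++ unzip2 P).
Proof.
elim: P => //= -[a b] P IH; rewrite -[pair_ends _]/(a :: b :: pair_ends P) /= perm_cons.
apply/permP => q; have /permP/(_ q) := IH.
by rewrite !count_cat /= => ->; lia.
Qed.

Lemma relabel_id f F : {in arcs F, f =1 id} -> map (relabel f) F = F.
Proof.
move=> fF; rewrite -[RHS]map_id; apply/eq_in_map => n nF.
have fn : {in ends n, f =1 id}.
  by move=> x xn; apply: fF; apply/flattenP; exists (ends n) => //; apply: map_f.
case: n nF fn => [u|a b c d|a b c d|a b|a b] _ fn /=; rewrite ?fn ?inE ?eqxx ?orbT //.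
by congr Vertex; rewrite -[RHS]map_id; apply/eq_in_map.
Qed.

(** * The move T4 on pure diagrams *)

Section PureT4.
Variables (K : comNzRingType) (y z w : K).
Local Notation Q F := (polyQ F y z w).

(** Each pass [(a, b)] is contracted by merging [b] into [a], so [h] sends every arc on the way to
    the arc of [top] at which its strand starts. The rest [G] is not relabelled, because the arcs
    that disappear do not occur in it. *)
Lemma polyQ_chain top P u G : chain top P u -> doubled (u ++ pair_ends P ++ arcs G) ->
  exists h : nat -> nat, [/\ respects P h, {in top, h =1 id} &
    Q (Vertex u :: points P ++ G) = Q (Vertex (map h u) :: G)].
Proof.
suff H : chain top P u -> doubled (u ++ pair_ends P ++ arcs G) ->
  exists h : nat -> nat, [/\ respects P h, {in top ++ arcs G, h =1 id} &
    Q (Vertex u :: points P ++ G) = Q (Vertex (map h u) :: G)].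
  move=> c d; have [h [h1 h2 h3]] := H c d; exists h; split=> // x xt.
  by apply: h2; rewrite mem_cat xt.
elim: {P}(size P) {-2}P (erefl (size P)) top u => [|n IH] [|[a b] P] // sP top u.
  by exists id; split=> //; rewrite map_id.
move=> c; inversion c as [|? ? ? T ? ? tT cT]; subst => {c} d.
(* Double counting: [b] is entered by the first pass and then left or final, which already gives its
   two ends. Hence it differs from [a] and occurs neither in [T] nor in [G]. *)
have cb q : (count q (u ++ pair_ends ((a, b) :: P) ++ arcs G) =
    q a + 2 * q b + count q T + 2 * count q (unzip2 P) + count q (arcs G))%N.
  have /permP/(_ q) := perm_chain cT; have /permP/(_ q) := perm_pair_ends P.
  rewrite -[pair_ends (_ :: _)]/([:: a; b] ++ pair_ends P) !count_cat /= => ->; lia.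
have bu : b \in unzip1 P ++ u by rewrite (perm_mem (perm_chain cT)) inE eqxx.
have := cb (pred1 b); rewrite d; last first.
  rewrite -[pair_ends _]/([:: a; b] ++ pair_ends P) -catA !mem_cat !inE eqxx.
  by rewrite !orbT.
rewrite /= eqxx; move eT: (count_mem b T) => nT; move eG: (count_mem b (arcs G)) => nG e0.
have ab : a != b by apply/negP => /eqP e; move: e0; rewrite e eqxx; lia.
have bT : b \notin T by apply/count_memPn; rewrite eT; lia.
have bG : b \notin arcs G by apply/count_memPn; rewrite eG; lia.
pose g := merge a b.
have gid : {in predC1 b, g =1 id} by move=> x; rewrite inE /g /merge => /negPf->.
have gG : {in arcs G, g =1 id}.
  by move=> x xG; apply: gid; rewrite inE; apply: contraNneq bG => <-.
have gT : map g (b :: T) = a :: T.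
  rewrite /= {1}/g /merge eqxx; congr (_ :: _); rewrite -[RHS]map_id; apply/eq_in_map=> x xT.
  by apply: gid; rewrite inE; apply: contraNneq bT => <-.
have := chain_map g cT; rewrite gT => cT'.
have [||h [h1 h2 h3]] := IH _ _ _ _ cT'; first by rewrite size_map; case: sP.
  have -> : arcs G = map g (arcs G) by rewrite -[LHS]map_id; apply/esym/eq_in_map.
  rewrite -map_pair_ends -!map_cat; apply: doubled_merge => //.
  apply: doubled_perm d; rewrite -[pair_ends (_ :: _)]/([:: a; b] ++ pair_ends P) -catA.
  by rewrite -[X in perm_eq _ X]/([:: a; b] ++ _) perm_catCA.
exists (h \o g); split.
- apply/respects_cons; split=> [|c e ce] /=.
    by rewrite /g /merge eqxx (negPf ab).
  by apply: h1; apply/mapP; exists (c, e).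
- move=> x; rewrite mem_cat (perm_mem tT) -mem_cat => xt /=.
  rewrite gid ?inE; first exact: h2.
  apply: contraTneq xt => ->; rewrite mem_cat inE eq_sym (negPf ab) (negPf bT).
  exact: bG.
rewrite map_comp -h3.
rewrite (polyQ_perm _ _ _ (perm_cons_cat _ [:: Point a b] (points P ++ G))).
rewrite polyQ_merge; last first.
  rewrite -{1}(_ : merge a b b = a); last by rewrite /merge eqxx.
  apply: map_f; rewrite -[arcs _]/(u ++ arcs (points P ++ G)) arcs_cat arcs_points.
  move: bu; rewrite !mem_cat (perm_mem (perm_pair_ends P)) mem_cat.
  by case/orP=> ->; rewrite ?orbT.
congr (polyQ _ _ _ _).
rewrite /= map_cat (relabel_id gG) /points -!map_comp; congr (_ :: _ ++ _).
Qed.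

Lemma braid_virtual s ns cs t : braid s ns cs t ->
  {subset ns <= [pred n | if n is Virtual _ _ _ _ then true else false]}.
Proof.
elim=> {s ns cs t} [s|s1 s2 i x x' j y0 y' ns cs t _ IH] // n.
by rewrite inE => /predU1P[->|/IH].
Qed.

Lemma braid_no_vertex s ns cs t : braid s ns cs t -> vertices ns = [::].
Proof. by elim. Qed.

Lemma braid_chain s ns cs t :
  braid s ns cs t -> chain (unzip2 s) (pairs ns) (unzip2 t).
Proof.
elim=> {s ns cs t} [s|s1 s2 i x x' j y0 y' ns cs t _ IH]; first exact: chain_nil.
rewrite /pairs /= -/(pairs ns) /unzip2 !map_cat /=.
apply: (chain_cons (T := map snd s1 ++ y0 :: map snd s2)).
  by rewrite perm_sym; apply: (perm_cons_cat x (map snd s1) (y0 :: _)).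
apply: (chain_cons (T := x' :: map snd s1 ++ map snd s2)).
  by apply/permP => q; rewrite /= !count_cat /=; lia.
move: IH; rewrite /unzip2 map_cat /=; apply: chain_perml.
by apply/permP => q; rewrite /= !count_cat /=; lia.
Qed.

(** An invariant of the descent: a strand number stays paired with the common value of [h] on the
    arcs of that strand, and a crossing only permutes these pairs. *)
Lemma braid_named s ns cs t (h : nat -> nat) : braid s ns cs t -> respects (pairs ns) h ->
  perm_eq [seq (p.1, h p.2) | p <- s] [seq (p.1, h p.2) | p <- t].
Proof.
elim=> {s ns cs t} [s|s1 s2 i x x' j y0 y' ns cs t _ IH] //.
rewrite /pairs /= -/(pairs ns) !respects_cons => -[ex [ey /IH p]].
apply: perm_trans p; rewrite !map_cat /= ex ey perm_cat2l.
by apply/permP => q /=; lia.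
Qed.

(** The numbers are distinct, so each one determines its partner; this is where the reversed
    numbering at the bottom of a half-twist becomes a reversed word. *)
Lemma zip_rev_iota n (A B : seq nat) : size A = n -> size B = n ->
  perm_eq (zip (iota 0 n) A) (zip (rev (iota 0 n)) B) -> B = rev A.
Proof.
move=> sA sB.
have -> : zip (rev (iota 0 n)) B = rev (zip (iota 0 n) (rev B)).
  by rewrite rev_zip ?revK // size_rev size_iota.
rewrite perm_sym (perm_rev (zip _ _)) => p.
apply: (canRL revK); apply: (@eq_from_nth _ 0%N); rewrite size_rev ?sA // sB => i Hi.
have : (i, nth 0%N (rev B) i) \in zip (iota 0 n) A.
  rewrite -(perm_mem p); apply/(nthP (0, 0)%N); exists i.
    by rewrite size_zip size_iota size_rev sB minnn.
  by rewrite nth_zip ?size_iota ?size_rev // nth_iota.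
case/(nthP (0, 0)%N) => k; rewrite size_zip size_iota sA minnn => Hk.
by rewrite nth_zip ?size_iota // nth_iota // => -[<- ->].
Qed.

Lemma polyQ_T4 top bot bot' ns G : size bot = size top -> half_twist top ns bot' -> pure G ->
  doubled (arcs (Vertex bot :: bar_points (zip top bot) ++ G)) ->
  doubled (arcs (Vertex bot' :: ns ++ G)) ->
  Q (Vertex bot :: bar_points (zip top bot) ++ G) = Q (Vertex bot' :: ns ++ G).
Proof.
move=> sb [sb' [cs br _]] pG d d'; set r := size top in sb sb' br.
transitivity (Q (Vertex (rev top) :: G)).
  rewrite polyQ_flip //.
  have c : chain top (zip top bot) (rev bot).
    by apply: chain_permr (chain_zip _); rewrite // perm_sym perm_rev.
  have [|h [h1 h2 ->]] := polyQ_chain c (G := G).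
    apply: doubled_perm d; rewrite -[arcs _]/(bot ++ arcs (bar_points (zip top bot) ++ G)).
    by rewrite arcs_cat arcs_bar_points perm_cat2r perm_sym perm_rev.
  congr (Q (Vertex _ :: _)); rewrite map_rev; congr rev.
  rewrite -[bot in LHS](@unzip2_zip _ _ top bot) ?sb // -[RHS](@unzip1_zip _ _ top bot) ?sb //.
  rewrite -map_comp; apply/eq_in_map => -[a b] ab /=; rewrite -(h1 _ _ ab).
  by apply: h2; rewrite -(@unzip1_zip _ _ top bot) ?sb //; apply: (map_f fst ab).
have vn := braid_virtual br.
rewrite (polyQ_perm _ _ _ (perm_cons_cat _ ns G)) polyQ_virtual //.
rewrite -(polyQ_perm _ _ _ (perm_cons_cat _ (points _) G)).
have c := braid_chain br.
rewrite unzip2_zip ?size_iota // unzip2_zip ?size_rev ?size_iota ?sb' // in c.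
have [|h [h1 h2 ->]] := polyQ_chain c (G := G).
  apply: doubled_perm d'; rewrite -[arcs _]/(bot' ++ arcs (ns ++ G)) arcs_cat.
  rewrite perm_cat2l perm_cat2r; have := @perm_arcs ns.
  rewrite (braid_no_vertex br); apply.
  by apply/hasPn => n /vn; case: n.
congr (Q (Vertex _ :: _)); apply/esym.
have E A I : size I = size A -> [seq (p.1, h p.2) | p <- zip I A] = zip I (map h A).
  by elim: I A => [|i I IH] [|a A] //= [/IH->].
have := braid_named br h1; rewrite !E ?size_rev ?size_iota // => /zip_rev_iota.
rewrite !size_map => /(_ (erefl _) sb') ->; congr rev; rewrite -[RHS]map_id; exact/eq_in_map.
Qed.
End PureT4.

(** * Sums over states *)

Lemma ra_rai : ra * rai = 1.
Proof.
rewrite /ra /rai -qpolyCM -polyCM (_ : laurentX * laurentV = 1) ?polyC1 //.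
by apply: val_inj; rewrite /= divff // tofrac_eq0 polyX_eq0.
Qed.

Lemma power_aS m : power_a (1 + m) = ra * power_a m.
Proof.
case: m => [n|[|n]]; first exact: exprS.
  exact/esym/ra_rai.
have -> : 1 + Negz n.+1 = Negz n by rewrite !NegzE; lia.
by rewrite [power_a (Negz n.+1)](exprS rai n.+1) mulrA ra_rai mul1r.
Qed.

Lemma power_aB m : power_a (m - 1) = rai * power_a m.
Proof.
have := power_aS (m - 1); rewrite (addrC 1) subrK => ->.
by rewrite mulrA (mulrC rai) ra_rai mul1r.
Qed.

Definition spin_weight (x : spin) : Rring :=
  match x with SpinPlus => ra | SpinMinus => rai | SpinZero => 1 end.

Definition weight (s : seq spin) : Rring :=
  power_a ((count_mem SpinPlus s)%:Z - (count_mem SpinMinus s)%:Z).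

Lemma weight_cons x s : weight (x :: s) = spin_weight x * weight s.
Proof.
rewrite /weight /=; set p := count_mem SpinPlus s; set q := count_mem SpinMinus s.
case: x => /=; last by rewrite mul1r.
- rewrite -power_aS; apply: (congr1 power_a); lia.
- rewrite -power_aB; apply: (congr1 power_a); lia.
Qed.

Definition node_sum (n : node) (f : code -> Rring) : Rring :=
  match n with
  | Classical a b c d => \sum_(x : spin) spin_weight x * f (smooth x a b c d)
  | _ => f [:: n]
  end.

(** The continuation [f] is applied to the complete state: Q is not a product over nodes, yet its
    sum can thus be unfolded node by node. *)
Fixpoint state_sum (E : code) (f : code -> Rring) : Rring :=
  if E is n :: E' then node_sum n (fun G => state_sum E' (fun G' => f (G ++ G')))
  else f [::].

Lemma sum_states E f :
  \sum_(s : (nb_classical E).-tuple spin) weight s * f (state E s) = state_sum E f.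
Proof.
elim: E f => [|n E IH] f.
  rewrite (eq_bigr (fun _ => f [::])); last first.
    by move=> s _; rewrite tuple0 /= /weight /= mul1r.
  by rewrite sumr_const card_tuple expn0.
case: n => [u|a b c d|a b c d|a b|a b]; rewrite /= -?IH //.
rewrite (reindex (fun p : spin * (nb_classical E).-tuple spin => cons_tuple p.1 p.2)) /=;
  last first.
  exists (fun t => (thead t, behead_tuple t)) => [[x t] _|t _] /=.
    by rewrite theadE; congr (_, _); apply: val_inj.
  by case/tupleP: t => x t; apply: val_inj; rewrite /= theadE.
rewrite -(pair_bigA _ (fun x (t : (nb_classical E).-tuple spin) =>
   weight (x :: t) * f (smooth x a b c d ++ state E t))) /=.
apply: eq_bigr => x _; rewrite -IH big_distrr /=; apply: eq_bigr => t _.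
by rewrite weight_cons mulrA.
Qed.

Lemma polyR_state_sum E :
  polyR E = state_sum E (fun F => polyQ F (- ra - 2%:R - rai) rz rw).
Proof. by rewrite -sum_states. Qed.

Lemma perm_smooth x a b c d : perm_eq (arcs (smooth x a b c d)) [:: a; b; c; d].
Proof. by case: x; apply/permP => q; rewrite /arcs /=; lia. Qed.

(** Smoothing a crossing keeps the multiset of arc ends, so the states of a well-formed code again
    have two ends for each arc; T4 and the removal of points rely on this. *)
Lemma eq_state_sum E f f' :
  (forall G, pure G -> perm_eq (arcs G) (arcs E) -> f G = f' G) ->
  state_sum E f = state_sum E f'.
Proof.
elim: E f f' => [|n E IH] f f' ff' /=; first exact: ff'.
have H G : pure G -> perm_eq (arcs G) (ends n) ->
    state_sum E (fun G' => f (G ++ G')) = state_sum E (fun G' => f' (G ++ G')).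
  move=> pG aG; apply: IH => G' pG' aG'; apply: ff'.
    by rewrite /pure has_cat negb_or; apply/andP.
  by rewrite arcs_cat; apply: perm_cat.
case: n ff' H => [u|a b c d|a b c d|a b|a b] _ H /=;
  try by apply: (H [:: _]); rewrite // /arcs /= cats0.
by apply: eq_bigr => x _; congr (_ * _); apply: H; [case: x | apply: perm_smooth].
Qed.

Lemma state_sum_pure E0 E f : pure E0 ->
  state_sum (E0 ++ E) f = state_sum E (fun G => f (E0 ++ G)).
Proof.
elim: E0 f => //= n E0 IH f; rewrite /pure /= negb_or => /andP[nC pE].
by case: n nC => //= *; rewrite IH.
Qed.

Lemma state_sum_relabel h E f :
  state_sum (map (relabel h) E) f = state_sum E (f \o map (relabel h)).
Proof.
elim: E f => //= n E IH f.
case: n => [u|a b c d|a b c d|a b|a b] /=; rewrite ?IH; try by apply: eq_state_sum.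
apply: eq_bigr => x _; rewrite IH; congr (_ * _); apply: eq_state_sum => G _ _.
by rewrite /= map_cat; case: x.
Qed.

Lemma node_sum_exchange n m (k : code -> code -> Rring) :
  node_sum n (fun G => node_sum m (fun H => k G H)) =
  node_sum m (fun H => node_sum n (fun G => k G H)).
Proof.
case: n => [u|a b c d|a b c d|a b|a b]; case: m => [v|a' b' c' d'|a' b' c' d'|a' b'|a' b'] //=.
under eq_bigr do rewrite big_distrr /=.
rewrite exchange_big /=; apply: eq_bigr => x _; rewrite big_distrr /=.
by apply: eq_bigr => x' _; rewrite mulrCA.
Qed.

Lemma eq_node_sum n f f' : f =1 f' -> node_sum n f = node_sum n f'.
Proof. by move=> ff'; case: n => *; rewrite /= ?ff' //; apply: eq_bigr => x _; rewrite ff'. Qed.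

(** Neighbouring nodes are swapped by exchanging their sums over spins; the invariance of [f]
    absorbs the new order of the nodes in each state. *)
Lemma state_sum_perm E E' f : (forall G G', perm_eq G G' -> f G = f G') ->
  perm_eq E E' -> state_sum E f = state_sum E' f.
Proof.
have swap n m E1 (g : code -> Rring) : (forall G G', perm_eq G G' -> g G = g G') ->
    state_sum [:: n, m & E1] g = state_sum [:: m, n & E1] g.
  move=> gP /=; rewrite node_sum_exchange; do 2!apply: eq_node_sum => ?.
  apply: eq_state_sum => G _ _; apply: gP.
  by rewrite perm_catCA.
have mid n E1 E2 (g : code -> Rring) : (forall G G', perm_eq G G' -> g G = g G') ->
    state_sum (E1 ++ n :: E2) g = state_sum (n :: E1 ++ E2) g.
  elim: E1 g => [//|m E1 IH] g gP; rewrite swap //.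
  apply: eq_node_sum => G; apply: IH => G1 G2 p.
  by apply: gP; rewrite perm_cat2l.
move=> fP; elim: E E' f fP => [|n E IH] E' f fP p.
  by rewrite perm_sym in p; rewrite (perm_nilP p).
have nE' : n \in E' by rewrite -(perm_mem p) mem_head.
case/splitPr: nE' p => E1 E2 p; rewrite mid //.
have {}p : perm_eq E (E1 ++ E2).
  by rewrite -(perm_cons n) (perm_trans p) // perm_sym perm_cons_cat.
apply: eq_node_sum => G; apply: IH => // G1 G2 p12.
by apply: fP; rewrite perm_cat2l.
Qed.

(** * Re-encodings and moves of diagrams with classical crossings *)

Section Moves.
Variables (y z w : Rring).
Local Notation Q F := (polyQ F y z w).
Local Notation stateQ E := (state_sum E (fun F => polyQ F y z w)).

(** A half turn preserves the over-strand and the under-strand, and each of the three smoothings is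
    symmetric under it. *)
Lemma polyQ_rotate_smooth x a b c d G :
  Q (smooth x a b c d ++ G) = Q (smooth x c d a b ++ G).
Proof.
case: x => /=; last first.
- by rewrite polyQ_rotate_vertex /= polyQ_rotate_vertex.
- apply: polyQ_same_strands => // [u|T q].
    rewrite -[arcs _]/([:: a; b; d; c] ++ arcs G) -[arcs (_ :: _)]/([:: c; d; b; a] ++ arcs G).
    by rewrite !mem_cat !inE; case: (u == a); case: (u == b); case: (u == c); case: (u == d).
  rewrite !respects_cons -!/(pairs _); intuition.
- apply: polyQ_same_strands => // [u|T q].
    rewrite -[arcs _]/([:: a; d; b; c] ++ arcs G) -[arcs (_ :: _)]/([:: c; b; d; a] ++ arcs G).
    by rewrite !mem_cat !inE; case: (u == a); case: (u == b); case: (u == c); case: (u == d).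
  rewrite !respects_cons -!/(pairs _); intuition.
Qed.

Lemma stateQ_rotate n n' s : rotate_node n n' -> stateQ (n :: s) = stateQ (n' :: s).
Proof.
case=> [a u|a b c d|a b c d|a b|a b] /=.
- by apply: eq_state_sum => G _ _; apply: polyQ_rotate_vertex.
- apply: eq_bigr => x _; congr (_ * _); apply: eq_state_sum => G _ _.
  exact: polyQ_rotate_smooth.
- apply: eq_state_sum => G _ _; apply: polyQ_same_strands => // [u|T q].
    rewrite -[arcs _]/([:: a; b; c; d] ++ arcs G) -[arcs (_ :: _)]/([:: b; c; d; a] ++ arcs G).
    by rewrite !mem_cat !inE; case: (u == a); case: (u == b); case: (u == c); case: (u == d).
  rewrite !respects_cons -!/(pairs _); intuition.
- apply: eq_state_sum => G _ _; apply: polyQ_same_strands => // [u|T q|r].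
  + rewrite -[arcs _]/([:: a; b] ++ arcs G) -[arcs (_ :: _)]/([:: b; a] ++ arcs G).
    by rewrite !mem_cat !inE; case: (u == a); case: (u == b).
  + rewrite !respects_cons -!/(pairs _); intuition.
  + by rewrite respects_cons => -[e _] c; rewrite /named_bars /= e.
- apply: eq_state_sum => G _ _; apply: polyQ_same_strands => // [u|T q].
    rewrite -[arcs _]/([:: a; b] ++ arcs G) -[arcs (_ :: _)]/([:: b; a] ++ arcs G).
    by rewrite !mem_cat !inE; case: (u == a); case: (u == b).
  rewrite !respects_cons -!/(pairs _); intuition.
Qed.

Lemma stateQ_same (E E' : diagram) : same E E' -> stateQ E = stateQ E'.
Proof.
elim=> {E E'} // [E1 E2 E3 _ -> _ ->|E E'|E E' n n' s|E E' f|E E' a b s] //.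
- by apply: state_sum_perm; apply: polyQ_perm.
- by move=> nn' -> ->; apply: stateQ_rotate.
- move=> fI ->; rewrite state_sum_relabel; apply: eq_state_sum => G _ _.
  by rewrite /= polyQ_relabel.
- case: E => E /well_formedP d _ ab /= eE ->; rewrite eE in d *.
  rewrite (state_sum_relabel (merge a b)) /=; apply: eq_state_sum => G _ aG /=.
  apply: polyQ_merge.
  (* The arc [a] has two ends, and only one of them lies on the removed point because [a != b]. *)
  have aS : a \in arcs s.
    rewrite -has_pred1 has_count; have := d a; rewrite mem_head => /(_ isT).
    by rewrite /= eqxx [b == a]eq_sym (negPf ab) -/(arcs s); case: (count_mem a (arcs s)).
  apply/mapP; exists a; first by rewrite (perm_mem aG).
  by rewrite /merge; case: ifP.
Qed.

Lemma stateQ_T1 (E E' : diagram) : T1 E E' -> stateQ E = stateQ E'.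
Proof.
case=> [a [b [c [d [e [s [-> ->]]]]]]] /=.
apply: eq_state_sum => G _ _; apply: polyQ_same_strands => // [u|T q|r].
- rewrite -[arcs _]/([:: a; b; b; c; d; e] ++ arcs G).
  rewrite -[arcs (_ :: _)]/([:: a; c; b; e; b; d] ++ arcs G) !mem_cat !inE.
  by case: (u == a); case: (u == b); case: (u == c); case: (u == d); case: (u == e).
- rewrite !respects_cons -!/(pairs _); intuition.
- by rewrite respects_cons => -[ab _] x; rewrite /named_bars /= ab.
Qed.

Lemma stateQ_T2 (E E' : diagram) : T2 E E' -> stateQ E = stateQ E'.
Proof.
case=> [a [b [c [s [-> ->]]]]] /=.
apply: eq_state_sum => G _ _; apply: polyQ_same_strands => // r.
rewrite respects_cons => -[ab _] x; rewrite /named_bars /= ab !oddD.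
by case: (r b == x); rewrite /= ?negbK.
Qed.

Lemma stateQ_T4 (E E' : diagram) : T4 E E' -> stateQ E = stateQ E'.
Proof.
have d : doubled (arcs E) by case: E => F /= /well_formedP.
have d' : doubled (arcs E') by case: E' => F /= /well_formedP.
case=> top [bot [bot' [ns [s [sb ht eE eE']]]]].
have pns : pure ns.
  by have [_ [cs br _]] := ht; apply/hasPn => n /(braid_virtual br); case: n.
rewrite eE in d *; rewrite eE' in d' *.
rewrite -[_ :: _ ++ s]/((Vertex bot :: bar_points (zip top bot)) ++ s).
rewrite -[Vertex bot' :: _]/((Vertex bot' :: ns) ++ s) !state_sum_pure; last first.
- by rewrite /pure /=; elim: (zip _ _).
- by [].
apply: eq_state_sum => G pG aG; apply: polyQ_T4 => //.
- apply: doubled_perm d; rewrite -[X in arcs X]/((Vertex bot :: bar_points (zip top bot)) ++ s).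
  rewrite -[X in perm_eq _ (arcs X)]/((Vertex bot :: bar_points (zip top bot)) ++ G).
  by rewrite !arcs_cat perm_cat2l perm_sym.
- apply: doubled_perm d'; rewrite -[X in arcs X]/((Vertex bot' :: ns) ++ s).
  rewrite -[X in perm_eq _ (arcs X)]/((Vertex bot' :: ns) ++ G).
  by rewrite !arcs_cat perm_cat2l perm_sym.
Qed.

End Moves.

Theorem proposition6p12 (E E' : diagram) :
  differ_by T1 E E' \/ differ_by T2 E E' \/ differ_by T4 E E' ->
  polyR E = polyR E'.
Proof.
suff main move : (forall D D' : diagram, move D D' ->
      forall y z w, state_sum D (fun F => polyQ F y z w) = state_sum D' (fun F => polyQ F y z w)) ->
    differ_by move E E' -> polyR E = polyR E'.
  by case=> [|[|]]; apply: main => D D' m y z w;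
    [apply: stateQ_T1 | apply: stateQ_T2 | apply: stateQ_T4].
move=> mP [D [D' [sD sD' m]]]; rewrite !polyR_state_sum.
rewrite (stateQ_same _ _ _ sD) (stateQ_same _ _ _ sD').
by case: m => /mP.
Qed.
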